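(* Let $\nu\in\mathbb{R}$, $\lambda\in\mathbb{C}$, and let $\phi$ be a nonconstant holomorphic self-map of $\mathbb{D}$, not the identity, which has a fixed point in $\mathbb{D}$ and for which $C_\phi$ is bounded on $\mathcal{S}_\nu$. Then the operator $\lambda C_\phi$ is recurrent on $\mathcal{S}_\nu$ if and only if $\phi$ is an elliptic automorphism of $\mathbb{D}$ and $|\lambda|=1$.
   Context: $\mathbb{D}$ is the open unit disk of $\mathbb{C}$. For $\nu\in\mathbb{R}$, the weighted Dirichlet space $\mathcal{S}_\nu$ is the Hilbert space of analytic functions $f(z)=\sum_{n\ge 0}a_nz^n$ on $\mathbb{D}$ with $\|f\|_\nu^2=\sum_{n\ge0}|a_n|^2(n+1)^{2\nu}<\infty$. For a self-map $\phi$ of $\mathbb{D}$, $C_\phi f=f\circ\phi$; it is known that $C_\phi$ is bounded on every $\mathcal{S}_\nu$ when $\phi$ is a linear fractional self-map of $\mathbb{D}$. A bounded linear operator $T$ on a Hilbert space $\mathcal{H}$ is recurrent if for every non-empty open $U\subset\mathcal{H}$ there is a positive integer $n$ with $T^n(U)\cap U\neq\emptyset$. A linear fractional map other than the identity with two distinct fixed points in $\hat{\mathbb{C}}=\mathbb{C}\cup\{\infty\}$ is conjugate (by a linear fractional map) to a dilation $z\mapsto\mu z$; it is elliptic if $|\mu|=1$. An elliptic self-map of $\mathbb{D}$ is always an automorphism of $\mathbb{D}$ with one fixed point in $\mathbb{D}$. *)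

(* Defs.v *)
From Stdlib Require Import Reals Lra Lia FunctionalExtensionality ProofIrrelevance.
From Coquelicot Require Import Coquelicot.
Local Open Scope R_scope.

(* Points of the open unit disk.  Two points with the same value are equal, by
   proof irrelevance (disk_eq). *)
Record disk : Type := Disk {
  disk_val :> C;
  disk_lt1 : Cmod disk_val < 1
}.

Lemma disk_eq (z w : disk) : disk_val z = disk_val w -> z = w.
Proof.
destruct z as [z Hz], w as [w Hw]; simpl; intros E; subst w.
f_equal; apply proof_irrelevance.
Qed.

(* Complex differentiability at every point of the disk.  It is a local
   property, so the values of the extension F outside the disk are irrelevant. *)
Definition holomorphic (f : disk -> C) : Prop :=
  exists F : C -> C,
    (forall z : disk, F z = f z) /\
    (forall z : disk, @ex_derive C_AbsRing C_NormedModule F (z : C)).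

(* The extended plane: None is the point at infinity. *)
Definition Chat : Type := option C.

Definition lft (a b c d : C) (p : Chat) : Chat :=
  match p with
  | Some z =>
      if Ceq_dec (c * z + d)%C 0%C then None
      else Some ((a * z + b) / (c * z + d))%C
  | None => if Ceq_dec c 0%C then None else Some (a / c)%C
  end.

Definition linear_fractional (M : Chat -> Chat) : Prop :=
  exists a b c d : C,
    (a * d - b * c)%C <> 0%C /\ forall p : Chat, M p = lft a b c d p.

Definition dilation (mu : C) : Chat -> Chat := lft mu 0 0 1.

Definition elliptic (M : Chat -> Chat) : Prop :=
  linear_fractional M /\
  (exists p : Chat, M p <> p) /\
  (exists p q : Chat, p <> q /\ M p = p /\ M q = q) /\
  (exists (S : Chat -> Chat) (mu : C),
     linear_fractional S /\ Cmod mu = 1 /\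
     forall p : Chat, S (M p) = dilation mu (S p)).

Definition automorphism (phi : disk -> disk) : Prop :=
  holomorphic (fun z => phi z) /\
  exists psi : disk -> disk,
    holomorphic (fun z => psi z) /\
    (forall z, psi (phi z) = z) /\ (forall z, phi (psi z) = z).

Definition elliptic_automorphism (phi : disk -> disk) : Prop :=
  automorphism phi /\
  exists M : Chat -> Chat,
    elliptic M /\ forall z : disk, M (Some (z : C)) = Some (phi z : C).

Definition weight (nu : R) (n : nat) : R := Rpower (INR (n + 1)) (2 * nu).

Definition wsq (nu : R) (a : nat -> C) (n : nat) : R :=
  Cmod (a n) ^ 2 * weight nu n.

Lemma pseries_part (p : C -> R) (a : nat -> C) (x : R) (l : C) :
  (forall u v : C, p (u + v)%C = p u + p v) ->
  (forall (t : R) (u : C), p (t * u)%C = t * p u) ->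
  (forall u : C, Rabs (p u) <= Cmod u) ->
  @is_pseries C_AbsRing C_NormedModule a (x : C) l ->
  is_pseries (fun n => p (a n)) x (p l).
Proof.
intros pD pZ pM H.
assert (Hs : forall n,
  p (sum_n (fun k => @scal C_AbsRing C_NormedModule (pow_n (x : C) k) (a k)) n)
  = sum_n (fun k => scal (pow_n x k) (p (a k))) n).
{ assert (Hp : forall k, @pow_n C_Ring (x : C) k = RtoC (pow_n x k)).
  { induction k as [|k IH]; [reflexivity|].
    simpl; rewrite IH; symmetry; apply RtoC_mult. }
  assert (Hk : forall k, p (@scal C_AbsRing C_NormedModule (pow_n (x : C) k) (a k))
    = scal (pow_n x k) (p (a k))).
  { intros k; rewrite Hp; apply pZ. }
  induction n as [|n IH].
  - rewrite !sum_O; apply Hk.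
  - rewrite !sum_Sn, <- IH, <- Hk; apply pD. }
apply (filterlim_ext _ _ Hs).
apply filterlim_locally; intros e.
assert (H' := proj1 (filterlim_locally_ball_norm _ _) H e).
revert H'; apply filter_imp; intros n Hn.
apply Rle_lt_trans with (2 := Hn).
set (s := sum_n _ n); change (Rabs (p s - p l) <= Cmod (s - l)%C).
replace (p s - p l) with (p (s - l)%C); [apply pM|].
unfold Cminus; rewrite pD.
replace (- l)%C with (RtoC (-1) * l)%C by (apply injective_projections; simpl; ring).
rewrite pZ; ring.
Qed.

Lemma pseries_part_unique (p : C -> R) (a b : nat -> C) (F : disk -> C) :
  (forall u v : C, p (u + v)%C = p u + p v) ->
  (forall (t : R) (u : C), p (t * u)%C = t * p u) ->
  (forall u : C, Rabs (p u) <= Cmod u) ->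
  (forall z : disk, @is_pseries C_AbsRing C_NormedModule a (z : C) (F z)) ->
  (forall z : disk, @is_pseries C_AbsRing C_NormedModule b (z : C) (F z)) ->
  forall n, p (a n) = p (b n).
Proof.
intros pD pZ pM Ha Hb n.
assert (dx : forall x : R, Rabs x < 1 -> Cmod (x : C) < 1)
  by (intros x Hx; rewrite Cmod_R; exact Hx).
assert (R0 : forall c : nat -> C,
  (forall z : disk, @is_pseries C_AbsRing C_NormedModule c (z : C) (F z)) ->
  Rbar_lt 0 (CV_radius (fun k => p (c k)))).
{ intros c Hc.
  assert (H2 : Rabs (/ 2) < 1) by (rewrite Rabs_pos_eq; lra).
  assert (Hs := pseries_part p c (/ 2) _ pD pZ pM (Hc (Disk _ (dx _ H2)))).
  apply Rbar_lt_le_trans with (Finite (Rabs (/ 2))).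
  - simpl; rewrite Rabs_pos_eq; lra.
  - apply Rbar_not_lt_le; intros Hlt.
    apply (CV_disk_outside _ _ Hlt).
    apply (is_lim_seq_ext (fun k => scal (pow_n (/ 2) k) (p (c k)))).
    + intros k; rewrite pow_n_pow; apply Rmult_comm.
    + apply ex_series_lim_0; eexists; exact Hs. }
apply (PSeries_ext_recip (fun k => p (a k)) (fun k => p (b k)) n);
  [apply R0, Ha | apply R0, Hb |].
exists (mkposreal 1 Rlt_0_1); intros x Hx.
assert (Hx' : Rabs x < 1).
{ change (Rabs (x - 0) < 1) in Hx; now rewrite Rminus_0_r in Hx. }
rewrite (is_pseries_unique _ _ _ (pseries_part p a x _ pD pZ pM (Ha (Disk _ (dx _ Hx'))))).
rewrite (is_pseries_unique _ _ _ (pseries_part p b x _ pD pZ pM (Hb (Disk _ (dx _ Hx'))))).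
reflexivity.
Qed.

Lemma taylor_unique (a b : nat -> C) (F : disk -> C) :
  (forall z : disk, @is_pseries C_AbsRing C_NormedModule a (z : C) (F z)) ->
  (forall z : disk, @is_pseries C_AbsRing C_NormedModule b (z : C) (F z)) ->
  forall n, a n = b n.
Proof.
intros Ha Hb n; apply injective_projections.
- apply (pseries_part_unique fst a b F); auto.
  + intros t u; simpl; ring.
  + intros u; apply Rle_trans with (2 := Rmax_Cmod u), Rmax_l.
- apply (pseries_part_unique snd a b F); auto.
  + intros t u; simpl; ring.
  + intros u; apply Rle_trans with (2 := Rmax_Cmod u), Rmax_r.
Qed.

(* The weighted Dirichlet space.  The Taylor coefficients are stored next to the
   function; they are determined by it (taylor_unique), so an element is the same
   thing as an analytic function with finite norm (dirichlet_ext). *)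
Record dirichlet (nu : R) : Type := Dirichlet {
  dfun :> disk -> C;
  taylor : nat -> C;
  taylor_sum : forall z : disk,
    @is_pseries C_AbsRing C_NormedModule taylor (z : C) (dfun z);
  taylor_sq : ex_series (wsq nu taylor)
}.
Arguments dfun {nu} _ _.
Arguments taylor {nu} _ _.
Arguments taylor_sum {nu} _ _.
Arguments taylor_sq {nu} _.
Arguments Dirichlet {nu} _ _ _ _.

Definition dnorm {nu : R} (f : dirichlet nu) : R :=
  sqrt (Series (wsq nu (taylor f))).

Section Space.

Variable nu : R.
Notation D := (dirichlet nu).

Lemma weight_pos (n : nat) : 0 < weight nu n.
Proof. apply exp_pos. Qed.

Lemma wsq_ge0 (a : nat -> C) (n : nat) : 0 <= wsq nu a n.
Proof.
apply Rmult_le_pos; [apply pow2_ge_0 | apply Rlt_le, weight_pos].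
Qed.

Lemma dirichlet_eq (f g : D) :
  (forall z, f z = g z) -> (forall n, taylor f n = taylor g n) -> f = g.
Proof.
destruct f as [f a Ha Ha'], g as [g b Hb Hb']; simpl; intros E1 E2.
assert (f = g) by (apply functional_extensionality; exact E1).
assert (a = b) by (apply functional_extensionality; exact E2).
subst; f_equal; apply proof_irrelevance.
Qed.

Lemma dirichlet_ext (f g : D) : (forall z, f z = g z) -> f = g.
Proof.
intros E; apply dirichlet_eq; [exact E|].
apply (taylor_unique _ _ g); [|apply taylor_sum].
intros z; rewrite <- E; apply taylor_sum.
Qed.

Lemma wsq_plus_le (a b : nat -> C) (t : R) (n : nat) : 0 < t ->
  wsq nu (fun k => (a k + b k)%C) n
    <= (1 + t) * wsq nu a n + (1 + / t) * wsq nu b n.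
Proof.
intros Ht; unfold wsq.
replace ((1 + t) * (Cmod (a n) ^ 2 * weight nu n) +
  (1 + / t) * (Cmod (b n) ^ 2 * weight nu n)) with
  (((1 + t) * Cmod (a n) ^ 2 + (1 + / t) * Cmod (b n) ^ 2) * weight nu n) by ring.
apply Rmult_le_compat_r; [apply Rlt_le, weight_pos|].
generalize (Cmod_triangle (a n) (b n)) (Cmod_ge_0 (a n + b n)%C).
generalize (Cmod (a n + b n)%C) (Cmod (a n)) (Cmod (b n)); intros x y z H0 H1.
assert (x ^ 2 <= (y + z) ^ 2) by (apply pow_incr; lra).
assert (0 <= / t * (t * y - z) ^ 2).
{ apply Rmult_le_pos; [apply Rlt_le, Rinv_0_lt_compat, Ht | apply pow2_ge_0]. }
replace ((1 + t) * y ^ 2 + (1 + / t) * z ^ 2)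
  with ((y + z) ^ 2 + / t * (t * y - z) ^ 2) by (field; lra).
lra.
Qed.

Lemma wsq_plus_ex (a b : nat -> C) :
  ex_series (wsq nu a) -> ex_series (wsq nu b) ->
  ex_series (wsq nu (fun k => (a k + b k)%C)).
Proof.
intros Ha Hb.
apply (ex_series_le (K := R_AbsRing) (V := R_CompleteNormedModule)) with
  (fun n => plus (scal (1 + 1) (wsq nu a n)) (scal (1 + / 1) (wsq nu b n))).
- intros n; change (Rabs (wsq nu (fun k => (a k + b k)%C) n) <=
    (1 + 1) * wsq nu a n + (1 + / 1) * wsq nu b n).
  rewrite Rabs_pos_eq by apply wsq_ge0.
  apply wsq_plus_le; lra.
- apply @ex_series_plus; apply @ex_series_scal; assumption.
Qed.

Lemma wsq_scal (k : C) (a : nat -> C) (n : nat) :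
  wsq nu (fun i => (k * a i)%C) n = Cmod k ^ 2 * wsq nu a n.
Proof. unfold wsq; rewrite Cmod_mult; ring. Qed.

Lemma wsq_scal_ex (k : C) (a : nat -> C) :
  ex_series (wsq nu a) -> ex_series (wsq nu (fun i => (k * a i)%C)).
Proof.
intros Ha.
apply ex_series_ext with (fun n => scal (Cmod k ^ 2) (wsq nu a n)).
- intros n; rewrite wsq_scal; reflexivity.
- apply @ex_series_scal; exact Ha.
Qed.

Definition dzero : D.
Proof.
refine (Dirichlet (fun _ => 0%C) (fun _ => 0%C) _ _).
- intros z; unfold is_pseries.
  apply (filterlim_ext (fun _ : nat => zero)).
  + intros n; symmetry.
    induction n as [|n IH].
    * rewrite sum_O; apply @scal_zero_r.
    * rewrite sum_Sn, IH; etransitivity; [apply @plus_zero_l | apply @scal_zero_r].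
  + apply filterlim_const.
- apply ex_series_ext with (fun _ => zero).
  + intros n; unfold wsq; rewrite Cmod_0; change (0 = 0 ^ 2 * weight nu n); ring.
  + exists zero; apply (filterlim_ext (fun _ : nat => zero)).
    * intros n; rewrite sum_n_const; change (0 = INR (S n) * 0); ring.
    * apply filterlim_const.
Defined.

Definition dplus (f g : D) : D.
Proof.
refine (Dirichlet (fun z => f z + g z)%C (fun n => taylor f n + taylor g n)%C _ _).
- intros z; apply (@is_pseries_plus C_AbsRing C_NormedModule);
    apply taylor_sum.
- apply wsq_plus_ex; apply taylor_sq.
Defined.

Definition dscal (k : C) (f : D) : D.
Proof.
refine (Dirichlet (fun z => k * f z)%C (fun n => k * taylor f n)%C _ _).
- intros z; apply (@is_pseries_scal C_AbsRing C_NormedModule);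
    [apply Cmult_comm | apply taylor_sum].
- apply wsq_scal_ex, taylor_sq.
Defined.

Definition dopp (f : D) : D.
Proof.
refine (Dirichlet (fun z => - f z)%C (fun n => - taylor f n)%C _ _).
- intros z; apply (@is_pseries_opp C_AbsRing C_NormedModule), taylor_sum.
- apply ex_series_ext with (wsq nu (taylor f)); [|apply taylor_sq].
  intros n; unfold wsq; rewrite Cmod_opp; reflexivity.
Defined.

Lemma dplus_comm (f g : D) : dplus f g = dplus g f.
Proof. apply dirichlet_eq; intros; apply Cplus_comm. Qed.

Lemma dplus_assoc (f g h : D) : dplus f (dplus g h) = dplus (dplus f g) h.
Proof. apply dirichlet_eq; intros; apply Cplus_assoc. Qed.

Lemma dplus_zero_r (f : D) : dplus f dzero = f.
Proof. apply dirichlet_eq; intros; apply Cplus_0_r. Qed.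

Lemma dplus_opp_r (f : D) : dplus f (dopp f) = dzero.
Proof. apply dirichlet_eq; intros; apply Cplus_opp_r. Qed.

Lemma dscal_assoc (x y : C) (f : D) :
  dscal x (dscal y f) = dscal (x * y)%C f.
Proof. apply dirichlet_eq; intros; apply Cmult_assoc. Qed.

Lemma dscal_one (f : D) : dscal 1%C f = f.
Proof. apply dirichlet_eq; intros; apply Cmult_1_l. Qed.

Lemma dscal_distr_l (x : C) (f g : D) :
  dscal x (dplus f g) = dplus (dscal x f) (dscal x g).
Proof. apply dirichlet_eq; intros; apply Cmult_plus_distr_l. Qed.

Lemma dscal_distr_r (x y : C) (f : D) :
  dscal (x + y)%C f = dplus (dscal x f) (dscal y f).
Proof. apply dirichlet_eq; intros; apply Cmult_plus_distr_r. Qed.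

Lemma dsq_ge0 (f : D) : 0 <= Series (wsq nu (taylor f)).
Proof.
replace 0 with (Series (fun _ : nat => 0)).
- apply Series_le; [|apply taylor_sq].
  intros n; split; [lra | apply wsq_ge0].
- rewrite (Series_ext _ (fun n => 0 * 0)) by (intros; ring).
  rewrite Series_scal_l; ring.
Qed.

Lemma dnorm_ge0 (f : D) : 0 <= dnorm f.
Proof. apply sqrt_pos. Qed.

Lemma dnorm_sq (f : D) : Series (wsq nu (taylor f)) = dnorm f ^ 2.
Proof. unfold dnorm; rewrite pow2_sqrt; [reflexivity | apply dsq_ge0]. Qed.

Lemma dnorm_triangle (f g : D) : dnorm (dplus f g) <= dnorm f + dnorm g.
Proof.
apply le_epsilon; intros e He.
set (A := dnorm f + e / 2); set (B := dnorm g + e / 2).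
assert (HA : 0 < A) by (generalize (dnorm_ge0 f); unfold A; lra).
assert (HB : 0 < B) by (generalize (dnorm_ge0 g); unfold B; lra).
replace (dnorm f + dnorm g + e) with (A + B) by (unfold A, B; field).
apply Rsqr_incr_0_var; [|lra].
rewrite !Rsqr_pow2, <- dnorm_sq.
set (t := B / A).
assert (Ht : 0 < t) by (apply Rdiv_lt_0_compat; assumption).
apply Rle_trans with
  ((1 + t) * Series (wsq nu (taylor f)) + (1 + / t) * Series (wsq nu (taylor g))).
- rewrite <- !Series_scal_l, <- Series_plus.
  + apply Series_le.
    * intros n; split; [apply wsq_ge0 | apply wsq_plus_le, Ht].
    * apply @ex_series_plus; apply @ex_series_scal; apply taylor_sq.
  + apply (@ex_series_scal R_AbsRing R_NormedModule), taylor_sq.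
  + apply (@ex_series_scal R_AbsRing R_NormedModule), taylor_sq.
- rewrite !dnorm_sq.
  assert (0 < / t) by (apply Rinv_0_lt_compat, Ht).
  apply Rle_trans with ((1 + t) * A ^ 2 + (1 + / t) * B ^ 2).
  + apply Rplus_le_compat; (apply Rmult_le_compat_l; [lra|]); apply pow_incr;
      (split; [apply dnorm_ge0 | unfold A, B; lra]).
  + right; unfold t; field; lra.
Qed.

Lemma dnorm_scal (k : C) (f : D) : dnorm (dscal k f) = Cmod k * dnorm f.
Proof.
unfold dnorm.
rewrite (Series_ext _ (fun n => Cmod k ^ 2 * wsq nu (taylor f) n))
  by (intros n; apply wsq_scal).
rewrite Series_scal_l, sqrt_mult by (apply pow2_ge_0 || apply dsq_ge0).
rewrite sqrt_pow2 by apply Cmod_ge_0; reflexivity.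
Qed.

Lemma dnorm_opp (f : D) : dnorm (dopp f) = dnorm f.
Proof.
unfold dnorm; f_equal; apply Series_ext; intros n.
unfold wsq; simpl taylor; rewrite Cmod_opp; reflexivity.
Qed.

Lemma dnorm_zero : dnorm dzero = 0.
Proof.
unfold dnorm; rewrite (Series_ext _ (fun n => 0 * 0)).
- rewrite Series_scal_l, Rmult_0_l; apply sqrt_0.
- intros n; unfold wsq; simpl taylor; rewrite Cmod_0; ring.
Qed.

Lemma dnorm_eq0 (f : D) : dnorm f = 0 -> f = dzero.
Proof.
intros H.
assert (T0 : forall n, taylor f n = 0%C).
{ intros n.
  assert (S0 : Series (wsq nu (taylor f)) = 0) by (rewrite dnorm_sq, H; ring).
  assert (wsq nu (taylor f) n <= 0).
  { assert (HL := Series_correct _ (taylor_sq f)); rewrite S0 in HL.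
    assert (HS : sum_n (wsq nu (taylor f)) n <= 0).
    { apply (is_lim_seq_incr_compare (sum_n (wsq nu (taylor f)))); [exact HL|].
      intros m; rewrite sum_Sn; generalize (wsq_ge0 (taylor f) (S m)).
      unfold plus; simpl; lra. }
    destruct n as [|n]; [rewrite sum_O in HS; exact HS|].
    rewrite sum_Sn in HS.
    assert (0 <= sum_n (wsq nu (taylor f)) n).
    { clear HS; induction n as [|n IH].
      - rewrite sum_O; apply wsq_ge0.
      - rewrite sum_Sn; generalize (wsq_ge0 (taylor f) (S n)).
        unfold plus; simpl; simpl in IH; lra. }
    unfold plus in HS; simpl in HS; lra. }
  apply Cmod_eq_0.
  destruct (Req_dec (Cmod (taylor f n)) 0) as [E|E]; [exact E|exfalso].
  assert (0 < Cmod (taylor f n) ^ 2)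
    by (apply pow_lt; generalize (Cmod_ge_0 (taylor f n)); lra).
  generalize (Rmult_lt_0_compat _ _ H1 (weight_pos n)).
  unfold wsq in H0; lra. }
apply dirichlet_eq; [|exact T0].
intros z; apply (@filterlim_locally_unique nat C_AbsRing C_NormedModule eventually _
  (sum_n (fun k => @scal C_AbsRing C_NormedModule (pow_n (z : C) k) (taylor f k)))).
- apply taylor_sum.
- apply (filterlim_ext
    (sum_n (fun k => @scal C_AbsRing C_NormedModule (pow_n (z : C) k) zero))).
  + intros n; apply sum_n_ext; intros k; rewrite T0; reflexivity.
  + apply (taylor_sum dzero z).
Qed.

Definition dirichlet_AbelianMonoid_mixin : AbelianMonoid.mixin_of D :=
  AbelianMonoid.Mixin D dplus dzero dplus_comm dplus_assoc dplus_zero_r.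
Canonical dirichlet_AbelianMonoid : AbelianMonoid :=
  AbelianMonoid.Pack D dirichlet_AbelianMonoid_mixin D.

Definition dirichlet_AbelianGroup_mixin : AbelianGroup.mixin_of dirichlet_AbelianMonoid :=
  AbelianGroup.Mixin dirichlet_AbelianMonoid dopp dplus_opp_r.
Canonical dirichlet_AbelianGroup : AbelianGroup :=
  AbelianGroup.Pack D (AbelianGroup.Class D _ dirichlet_AbelianGroup_mixin) D.

Definition dirichlet_ModuleSpace_mixin : ModuleSpace.mixin_of C_Ring dirichlet_AbelianGroup :=
  ModuleSpace.Mixin C_Ring dirichlet_AbelianGroup
    dscal dscal_assoc dscal_one dscal_distr_l dscal_distr_r.
Canonical dirichlet_ModuleSpace : ModuleSpace C_Ring :=
  ModuleSpace.Pack C_Ring D (ModuleSpace.Class C_Ring D _ dirichlet_ModuleSpace_mixin) D.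

Definition dball (f : D) (e : R) (g : D) : Prop := dnorm (minus g f) < e.

Lemma dball_center (f : D) (e : posreal) : dball f e f.
Proof.
unfold dball; rewrite minus_eq_zero.
change (dnorm dzero < e); rewrite dnorm_zero; apply cond_pos.
Qed.

Lemma dball_sym (f g : D) (e : R) : dball f e g -> dball g e f.
Proof.
unfold dball; rewrite <- (opp_minus g f).
change (dnorm (minus g f) < e -> dnorm (dopp (minus g f)) < e).
now rewrite dnorm_opp.
Qed.

Lemma dball_triangle (f g h : D) (e1 e2 : R) :
  dball f e1 g -> dball g e2 h -> dball f (e1 + e2) h.
Proof.
unfold dball; intros H1 H2.
rewrite (minus_trans g).
apply Rle_lt_trans with (1 := dnorm_triangle _ _); lra.
Qed.

Definition dirichlet_UniformSpace_mixin : UniformSpace.mixin_of D :=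
  UniformSpace.Mixin D dzero dball dball_center dball_sym dball_triangle.
Canonical dirichlet_UniformSpace : UniformSpace :=
  UniformSpace.Pack D dirichlet_UniformSpace_mixin D.

Canonical dirichlet_NormedModuleAux : NormedModuleAux C_AbsRing :=
  NormedModuleAux.Pack C_AbsRing D
    (NormedModuleAux.Class C_AbsRing D
       (ModuleSpace.class C_Ring dirichlet_ModuleSpace)
       dirichlet_UniformSpace_mixin) D.

Lemma dnorm_scal_le (k : C_AbsRing) (f : D) :
  dnorm (scal k f) <= abs k * dnorm f.
Proof. right; apply dnorm_scal. Qed.

Lemma dball_norm (f g : D) (e : posreal) :
  ball f e g -> dnorm (minus g f) < 1 * e.
Proof. rewrite Rmult_1_l; exact (fun H => H). Qed.

Definition dirichlet_NormedModule_mixin :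
    NormedModule.mixin_of C_AbsRing dirichlet_NormedModuleAux :=
  NormedModule.Mixin C_AbsRing dirichlet_NormedModuleAux dnorm 1
    dnorm_triangle dnorm_scal_le (fun _ _ _ H => H) dball_norm dnorm_eq0.
Canonical dirichlet_NormedModule : NormedModule C_AbsRing :=
  NormedModule.Pack C_AbsRing D
    (NormedModule.Class C_AbsRing D _ dirichlet_NormedModule_mixin) D.

End Space.

(* At most one T satisfies this (dirichlet_ext), and one exists exactly when
   f o phi lies in the space for every f in it. *)
Definition composition_operator {nu : R} (phi : disk -> disk)
    (T : dirichlet nu -> dirichlet nu) : Prop :=
  forall (f : dirichlet nu) (z : disk), T f z = f (phi z).

Definition recurrent {H : UniformSpace} (T : H -> H) : Prop :=
  forall U : H -> Prop, open U -> (exists x, U x) ->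
    exists n : nat, (0 < n)%nat /\ exists x, U x /\ U (Nat.iter n T x).

(* Main.v *)
Require Import Defs.
From Stdlib Require Import ZArith Reals Lra Lia List Classical FunctionalExtensionality.
From Coquelicot Require Import Coquelicot.
Local Open Scope R_scope.

(** Let p be the fixed point and mob p the disk automorphism taking p to 0.
    Evaluation at p and differentiation at p are continuous eigenfunctionals of
    T = lambda C_phi, with eigenvalues lambda and lambda phi'(p); recurrence
    forces both to have modulus 1.  Conversely, an elliptic phi has a derivative
    of modulus 1 at p.  In both directions the equality case of the Schwarz
    lemma gives mob p o phi = mu mob p with |mu| = 1: phi is a rotation about p.
    Such a phi is an elliptic automorphism.  When also |lambda| = 1, every power
    of mob p is an eigenvector of T with unimodular eigenvalue, and recurrence
    follows from the density of the polynomials in mob p together with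
    simultaneous Diophantine approximation of lambda and mu. *)

(** The exponent nu matters only through the fact that (n+1)^(2 nu) grows more slowly than s^n for
    every s > 1. Hence series converging beyond the closed disk lie in every space, with norm
    controlled by the geometric decay of their coefficients, and evaluation and differentiation at p
    are bounded, for all nu alike.

    Function theory is done on coefficients instead of contour integrals. A pointwise inequality on
    a circle passes to the square sums of Taylor coefficients ([parseval_le]); this gives both the
    Cauchy estimates and the equality case of the Schwarz lemma. For the latter, multiplying by the
    kernel 1/(1 - conj p z) keeps the point p in place, so that no change of variable in a power
    series is needed.

    Composition with [mob p] is not isometric for a general weight, so the density of its
    polynomials is not simply transported from that of ordinary polynomials. It comes from uniform
    approximation on a circle slightly larger than the unit circle, where decay of the coefficients
    beats any weight. *)

(** * Finite sums and limits of complex sequences *)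

Fixpoint csum (u : nat -> C) (n : nat) : C :=
  match n with O => 0%C | S m => (csum u m + u m)%C end.

Fixpoint rsum (u : nat -> R) (n : nat) : R :=
  match n with O => 0 | S m => rsum u m + u m end.

(** Stated through the real sequence of distances, so that comparison theorems for real limits apply
    directly; [Clim_filterlim] links it to the filter form. *)
Definition Clim (u : nat -> C) (l : C) : Prop :=
  is_lim_seq (fun n => Cmod (u n - l)%C) 0.

Lemma csum_ext (u v : nat -> C) (n : nat) :
  (forall k, (k < n)%nat -> u k = v k) -> csum u n = csum v n.
Proof.
induction n as [|n IH]; intros H; simpl; [reflexivity|].
rewrite IH, H; [reflexivity | lia | intros; apply H; lia].
Qed.

Lemma csum_plus (u v : nat -> C) (n : nat) :
  csum (fun k => u k + v k)%C n = (csum u n + csum v n)%C.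
Proof. induction n as [|n IH]; simpl; [|rewrite IH]; ring. Qed.

Lemma csum_scal (c : C) (u : nat -> C) (n : nat) :
  csum (fun k => c * u k)%C n = (c * csum u n)%C.
Proof. induction n as [|n IH]; simpl; [|rewrite IH]; ring. Qed.

Lemma csum_exchange (u : nat -> nat -> C) (m n : nat) :
  csum (fun i => csum (u i) n) m = csum (fun j => csum (fun i => u i j) m) n.
Proof.
induction m as [|m IH]; simpl.
- induction n as [|n IHn]; simpl; [|rewrite <- IHn]; ring.
- rewrite IH, <- csum_plus; reflexivity.
Qed.

Lemma csum_conj (u : nat -> C) (n : nat) :
  Cconj (csum u n) = csum (fun k => Cconj (u k)) n.
Proof.
induction n as [|n IH]; simpl.
- apply injective_projections; simpl; ring.
- rewrite Cplus_conj, IH; reflexivity.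
Qed.

Lemma csum_RtoC (u : nat -> R) (n : nat) :
  csum (fun k => RtoC (u k)) n = RtoC (rsum u n).
Proof. induction n as [|n IH]; simpl; [|rewrite IH, RtoC_plus]; reflexivity. Qed.

Lemma csum_zero (u : nat -> C) (n : nat) :
  (forall k, (k < n)%nat -> u k = 0%C) -> csum u n = 0%C.
Proof.
induction n as [|n IH]; intros H; simpl; [reflexivity|].
rewrite IH, H; [ring | lia | intros; apply H; lia].
Qed.

Lemma csum_single (u : nat -> C) (i n : nat) : (i < n)%nat ->
  (forall k, (k < n)%nat -> k <> i -> u k = 0%C) -> csum u n = u i.
Proof.
induction n as [|n IH]; intros Hi H; [lia|]; simpl.
destruct (Nat.eq_dec i n) as [->|E].
- rewrite csum_zero; [ring | intros; apply H; lia].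
- rewrite IH, (H n); [ring | lia | lia | lia | intros; apply H; lia].
Qed.

Lemma rsum_le (u v : nat -> R) (n : nat) :
  (forall k, (k < n)%nat -> u k <= v k) -> rsum u n <= rsum v n.
Proof.
induction n as [|n IH]; intros H; simpl; [lra|].
apply Rplus_le_compat; [apply IH; intros|]; apply H; lia.
Qed.

Lemma rsum_ext (u v : nat -> R) (n : nat) :
  (forall k, (k < n)%nat -> u k = v k) -> rsum u n = rsum v n.
Proof. intros H; apply Rle_antisym; apply rsum_le; intros; rewrite H; lra || lia. Qed.

Lemma rsum_plus (u v : nat -> R) (n : nat) :
  rsum (fun k => u k + v k) n = rsum u n + rsum v n.
Proof. induction n as [|n IH]; simpl; [|rewrite IH]; ring. Qed.

Lemma rsum_scal (c : R) (u : nat -> R) (n : nat) :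
  rsum (fun k => c * u k) n = c * rsum u n.
Proof. induction n as [|n IH]; simpl; [|rewrite IH]; ring. Qed.

Lemma rsum_const (c : R) (n : nat) : rsum (fun _ => c) n = INR n * c.
Proof. induction n as [|n IH]; [simpl; ring|]. rewrite S_INR; simpl; rewrite IH; ring. Qed.

Lemma rsum_ge0 (u : nat -> R) (n : nat) : (forall k, 0 <= u k) -> 0 <= rsum u n.
Proof. intros H; induction n as [|n IH]; simpl; [|generalize (H n)]; lra. Qed.

Lemma rsum_mono (u : nat -> R) (m n : nat) :
  (forall k, 0 <= u k) -> (m <= n)%nat -> rsum u m <= rsum u n.
Proof. intros H; induction 1; simpl; [|generalize (H m0)]; lra. Qed.

Lemma rsum_term (u : nat -> R) (k n : nat) :
  (forall i, 0 <= u i) -> (k < n)%nat -> u k <= rsum u n.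
Proof.
intros H Hk; apply Rle_trans with (rsum u (S k)).
- simpl; generalize (rsum_ge0 u k H); lra.
- apply rsum_mono; [exact H | lia].
Qed.

Lemma rsum_geom (x : R) (n : nat) : 0 <= x < 1 -> rsum (pow x) n <= / (1 - x).
Proof.
intros Hx.
assert (E : rsum (pow x) n = (1 - x ^ n) * / (1 - x)).
{ induction n as [|n IH]; simpl; [ring|]. rewrite IH; field; lra. }
rewrite E; rewrite <- (Rmult_1_l (/ (1 - x))) at 2.
apply Rmult_le_compat_r; [apply Rlt_le, Rinv_0_lt_compat; lra|].
generalize (pow_le x n); lra.
Qed.

Lemma Clim_ext (u v : nat -> C) (l : C) : (forall n, u n = v n) -> Clim u l -> Clim v l.
Proof. intros E; apply is_lim_seq_ext; intros n; rewrite E; reflexivity. Qed.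

Lemma Clim_squeeze (u : nat -> C) (l : C) (v : nat -> R) :
  (forall n, Cmod (u n - l)%C <= v n) -> is_lim_seq v 0 -> Clim u l.
Proof.
intros H Hv; apply is_lim_seq_le_le with (fun _ => 0) v; [|apply is_lim_seq_const|exact Hv].
intros n; split; [apply Cmod_ge_0 | apply H].
Qed.

Lemma lim_geom (M x : R) : 0 <= x < 1 -> is_lim_seq (fun n => M * x ^ n) 0.
Proof.
intros Hx; replace (Finite 0) with (Rbar_mult M 0) by (simpl; f_equal; ring).
apply is_lim_seq_scal_l, is_lim_seq_geom; rewrite Rabs_pos_eq; lra.
Qed.

Lemma Clim_bound (u : nat -> C) (l c : C) (B : R) (N : nat) :
  Clim u l -> (forall n, (N <= n)%nat -> Cmod (u n - c)%C <= B) -> Cmod (l - c)%C <= B.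
Proof.
intros Hu H.
assert (HL : is_lim_seq (fun n => Cmod (u n - l)%C + B) (0 + B)).
{ apply is_lim_seq_plus'; [exact Hu | apply is_lim_seq_const]. }
rewrite Rplus_0_l in HL.
apply (is_lim_seq_le_loc (fun _ => Cmod (l - c)%C) _ _ _) with (2 := is_lim_seq_const _) (3 := HL).
exists N; intros n Hn.
replace (l - c)%C with (- (u n - l) + (u n - c))%C by ring.
apply Rle_trans with (1 := Cmod_triangle _ _); rewrite Cmod_opp.
generalize (H n Hn); lra.
Qed.

Lemma Clim_unique (u : nat -> C) (l l' : C) : Clim u l -> Clim u l' -> l = l'.
Proof.
intros H H'.
assert (E : Rbar_le (Cmod (l - l')%C) 0).
{ replace 0 with (0 + 0) by ring.
  apply is_lim_seq_le with (fun _ => Cmod (l - l')%C) (fun n => Cmod (u n - l)%C + Cmod (u n - l')%C).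
  - intros n; replace (l - l')%C with (- (u n - l) + (u n - l'))%C by ring.
    apply Rle_trans with (1 := Cmod_triangle _ _); rewrite Cmod_opp; lra.
  - apply is_lim_seq_const.
  - apply is_lim_seq_plus'; assumption. }
simpl in E; apply (proj2 (Ceq_minus _ _)), Cmod_eq_0.
generalize (Cmod_ge_0 (l - l')%C); lra.
Qed.

Lemma Clim_plus (u v : nat -> C) (l l' : C) :
  Clim u l -> Clim v l' -> Clim (fun n => u n + v n)%C (l + l')%C.
Proof.
intros H H'; apply Clim_squeeze with (fun n => Cmod (u n - l)%C + Cmod (v n - l')%C).
- intros n; replace (u n + v n - (l + l'))%C with ((u n - l) + (v n - l'))%C by ring.
  apply Cmod_triangle.
- replace 0 with (0 + 0) by ring; apply is_lim_seq_plus'; assumption.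
Qed.

Lemma Clim_scal (c : C) (u : nat -> C) (l : C) :
  Clim u l -> Clim (fun n => c * u n)%C (c * l)%C.
Proof.
intros H; apply Clim_squeeze with (fun n => Cmod c * Cmod (u n - l)%C).
- intros n; replace (c * u n - c * l)%C with (c * (u n - l))%C by ring.
  rewrite Cmod_mult; lra.
- replace (Finite 0) with (Rbar_mult (Cmod c) 0) by (simpl; f_equal; ring).
  apply is_lim_seq_scal_l, H.
Qed.

Lemma Clim_const (c : C) : Clim (fun _ => c) c.
Proof.
apply Clim_squeeze with (fun _ => 0); [|apply is_lim_seq_const].
intros _; replace (c - c)%C with (RtoC 0) by ring; rewrite Cmod_0; lra.
Qed.

Lemma Clim_incr (u : nat -> C) (l : C) : Clim u l <-> Clim (fun n => u (S n)) l.
Proof. exact (is_lim_seq_incr_1 (fun n => Cmod (u n - l)%C) 0). Qed.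

Lemma Clim_0 (u : nat -> C) (M x : R) :
  0 <= x < 1 -> (forall n, Cmod (u n) <= M * x ^ n) -> Clim u 0.
Proof.
intros Hx H; apply Clim_squeeze with (fun n => M * x ^ n); [|apply lim_geom, Hx].
intros n; replace (u n - 0)%C with (u n) by ring; apply H.
Qed.

(** * Partial sums, convergence and tails of series *)

Lemma pow_n_Cpow (z : C) (n : nat) : @pow_n C_Ring z n = (z ^ n)%C.
Proof. induction n as [|n IH]; [|simpl; rewrite IH]; reflexivity. Qed.

Lemma sum_n_csum (u : nat -> C) (n : nat) :
  @sum_n (AbelianGroup.AbelianMonoid C_AbelianGroup) u n = csum u (S n).
Proof.
induction n as [|n IH].
- rewrite sum_O; simpl; ring.
- rewrite sum_Sn, IH; reflexivity.
Qed.

Lemma Clim_filterlim (u : nat -> C) (l : C) :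
  Clim u l <-> filterlim u eventually (@locally C_NormedModule l).
Proof.
split; intros H.
- apply filterlim_locally_ball_norm; intros e.
  destruct (proj2 (is_lim_seq_spec _ _) H e) as [N HN].
  exists N; intros n Hn; specialize (HN n Hn).
  rewrite Rminus_0_r, Rabs_pos_eq in HN by apply Cmod_ge_0; exact HN.
- apply is_lim_seq_spec; intros e.
  destruct (proj1 (@filterlim_locally_ball_norm C_AbsRing nat C_NormedModule eventually _ u l) H e) as [N HN].
  exists N; intros n Hn; rewrite Rminus_0_r, Rabs_pos_eq by apply Cmod_ge_0.
  exact (HN n Hn).
Qed.

Lemma is_pseries_Clim (a : nat -> C) (z l : C) :
  @is_pseries C_AbsRing C_NormedModule a z l <->
  Clim (csum (fun k => a k * z ^ k)%C) l.
Proof.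
rewrite Clim_incr, Clim_filterlim.
assert (E : forall n, sum_n (fun k => @scal C_AbsRing C_NormedModule (pow_n z k) (a k)) n
  = csum (fun k => a k * z ^ k)%C (S n)).
{ intros n; rewrite <- sum_n_csum; apply sum_n_ext; intros k.
  rewrite pow_n_Cpow; apply Cmult_comm. }
split; intros H.
- exact (filterlim_ext _ _ E H).
- refine (filterlim_ext _ _ _ H); intros n; rewrite E; reflexivity.
Qed.

Lemma sum_n_rsum (u : nat -> R) (n : nat) : sum_n u n = rsum u (S n).
Proof.
induction n as [|n IH].
- rewrite sum_O; simpl; ring.
- rewrite sum_Sn, IH; reflexivity.
Qed.

Lemma series_bounded (u : nat -> R) (B : R) :
  (forall n, 0 <= u n) -> (forall n, rsum u n <= B) -> ex_series u /\ Series u <= B.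
Proof.
intros H HB.
assert (HX : ex_series u).
{ destruct (ex_finite_lim_seq_incr (sum_n u) B) as [l Hl].
  - intros n; rewrite sum_Sn; generalize (H (S n)); unfold plus; simpl; lra.
  - intros n; rewrite sum_n_rsum; apply HB.
  - exists l; exact Hl. }
split; [exact HX|].
assert (L := Series_correct _ HX).
apply (is_lim_seq_le (sum_n u) (fun _ => B) (Series u) B);
  [intros n; rewrite sum_n_rsum; apply HB | exact L | apply is_lim_seq_const].
Qed.

Lemma rsum_le_Series (u : nat -> R) (n : nat) :
  (forall n, 0 <= u n) -> ex_series u -> rsum u n <= Series u.
Proof.
intros H HX; apply Rle_trans with (rsum u (S n)); [simpl; generalize (H n); lra|].
rewrite <- sum_n_rsum.
apply (is_lim_seq_incr_compare (sum_n u)); [exact (Series_correct _ HX)|].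
intros m; rewrite sum_Sn; generalize (H (S m)); unfold plus; simpl; lra.
Qed.

Lemma series_complete (u : nat -> C) (M x : R) :
  0 <= x < 1 -> (forall n, Cmod (u n) <= M * x ^ n) -> exists l, Clim (csum u) l.
Proof.
intros Hx H.
destruct (@ex_series_le C_AbsRing C_CompleteNormedModule u (fun n => M * x ^ n)) as [l Hl].
- exact H.
- apply (@ex_series_scal R_AbsRing R_NormedModule), ex_series_geom; rewrite Rabs_pos_eq; lra.
- exists l; apply Clim_incr, Clim_filterlim.
  refine (filterlim_ext _ _ _ Hl); apply sum_n_csum.
Qed.

Lemma csum_tail (u : nat -> C) (M x : R) (N n : nat) :
  0 <= x < 1 -> (forall k, Cmod (u k) <= M * x ^ k) -> (N <= n)%nat ->
  Cmod (csum u n - csum u N)%C <= M * x ^ N * / (1 - x).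
Proof.
intros Hx H Hn; replace n with (N + (n - N))%nat by lia; generalize (n - N)%nat; clear n Hn.
assert (HM : 0 <= M).
{ generalize (H O) (Cmod_ge_0 (u O)); simpl; lra. }
intros m; assert (E : Cmod (csum u (N + m) - csum u N)%C <= M * x ^ N * rsum (pow x) m).
{ induction m as [|m IH].
  - rewrite Nat.add_0_r; replace (csum u N - csum u N)%C with (RtoC 0) by ring.
    rewrite Cmod_0; simpl; lra.
  - rewrite Nat.add_succ_r; simpl.
    replace (csum u (N + m) + u (N + m)%nat - csum u N)%C
      with ((csum u (N + m) - csum u N) + u (N + m)%nat)%C by ring.
    apply Rle_trans with (1 := Cmod_triangle _ _).
    generalize (H (N + m)%nat); rewrite pow_add; lra. }
apply Rle_trans with (1 := E), Rmult_le_compat_l; [|apply rsum_geom, Hx].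
apply Rmult_le_pos; [exact HM | apply pow_le; lra].
Qed.

Lemma Clim_tail (u : nat -> C) (l : C) (M x : R) (N : nat) :
  0 <= x < 1 -> (forall k, Cmod (u k) <= M * x ^ k) -> Clim (csum u) l ->
  Cmod (l - csum u N)%C <= M * x ^ N * / (1 - x).
Proof.
intros Hx H Hl; apply (Clim_bound _ _ _ _ N Hl); intros n Hn.
apply csum_tail; assumption.
Qed.

(** * Power series with geometrically bounded coefficients *)

(** Here [r] is the reciprocal of a radius: F is given by its power series on |z| < 1/r and is
    unconstrained elsewhere. An element of the space satisfies this for every r > 1, and [mob p] for
    every r > |p|, so r < 1 expresses analyticity beyond the closed disk. *)
Definition geo (r : R) (F : C -> C) (a : nat -> C) : Prop :=
  (exists M, forall n, Cmod (a n) <= M * r ^ n) /\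
  forall z, Cmod z * r < 1 -> Clim (csum (fun k => a k * z ^ k)%C) (F z).

Lemma geo_ext (r : R) (F G : C -> C) (a : nat -> C) :
  (forall z, Cmod z * r < 1 -> F z = G z) -> geo r F a -> geo r G a.
Proof.
intros E [HM H]; split; [exact HM|].
intros z Hz; rewrite <- E by exact Hz; apply H, Hz.
Qed.

Lemma term_bound (r M : R) (a : nat -> C) (z : C) :
  (forall n, Cmod (a n) <= M * r ^ n) ->
  forall n, Cmod (a n * z ^ n)%C <= M * (Cmod z * r) ^ n.
Proof.
intros H n; rewrite Cmod_mult, Cmod_pow, Rpow_mult_distr.
replace (M * (Cmod z ^ n * r ^ n)) with (M * r ^ n * Cmod z ^ n) by ring.
apply Rmult_le_compat_r; [apply pow_le, Cmod_ge_0 | apply H].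
Qed.

(** The coefficients of a constant; [shift] and [gdiv] give those of z F(z) and F(z)/(1 - q z).
    Every function built from [mob p] is assembled from these. *)
Definition delta (c : C) (n : nat) : C := match n with O => c | S _ => 0%C end.

Definition shift (a : nat -> C) (n : nat) : C := match n with O => 0%C | S m => a m end.

Fixpoint gdiv (q : C) (a : nat -> C) (n : nat) : C :=
  match n with O => a O | S m => (a (S m) + q * gdiv q a m)%C end.

Lemma geo_const (r : R) (c : C) : 0 < r -> geo r (fun _ => c) (delta c).
Proof.
intros Hr; split.
- exists (Cmod c); intros [|n]; simpl; [lra|].
  rewrite Cmod_0; apply Rmult_le_pos; [apply Cmod_ge_0|].
  change (0 <= r ^ S n); apply pow_le; lra.
- intros z _; apply Clim_incr; apply Clim_ext with (fun _ => c); [|apply Clim_const].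
  intros n; induction n as [|n IH]; simpl; [ring|].
  simpl in IH; rewrite <- IH; ring.
Qed.

Lemma geo_plus (r : R) (F G : C -> C) (a b : nat -> C) :
  geo r F a -> geo r G b -> geo r (fun z => F z + G z)%C (fun n => a n + b n)%C.
Proof.
intros [[M HM] HF] [[M' HM'] HG]; split.
- exists (M + M'); intros n; apply Rle_trans with (1 := Cmod_triangle _ _).
  generalize (HM n) (HM' n); lra.
- intros z Hz.
  apply Clim_ext with (fun n => csum (fun k => a k * z ^ k)%C n + csum (fun k => b k * z ^ k)%C n)%C.
  + intros n; rewrite <- csum_plus; apply csum_ext; intros; ring.
  + apply Clim_plus; [apply HF | apply HG]; exact Hz.
Qed.

Lemma geo_scal (r : R) (c : C) (F : C -> C) (a : nat -> C) :
  geo r F a -> geo r (fun z => c * F z)%C (fun n => c * a n)%C.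
Proof.
intros [[M HM] HF]; split.
- exists (Cmod c * M); intros n; rewrite Cmod_mult, Rmult_assoc.
  apply Rmult_le_compat_l; [apply Cmod_ge_0 | apply HM].
- intros z Hz.
  apply Clim_ext with (fun n => c * csum (fun k => a k * z ^ k)%C n)%C.
  + intros n; rewrite <- csum_scal; apply csum_ext; intros; ring.
  + apply Clim_scal, HF, Hz.
Qed.

Lemma csum_shift (a : nat -> C) (z : C) (n : nat) :
  csum (fun k => shift a k * z ^ k)%C (S n) = (z * csum (fun k => a k * z ^ k)%C n)%C.
Proof.
induction n as [|n IH]; [simpl; ring|].
change (csum (fun k => shift a k * z ^ k)%C (S (S n)))
  with (csum (fun k => shift a k * z ^ k) (S n) + shift a (S n) * z ^ S n)%C.
rewrite IH; simpl; ring.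
Qed.

Lemma geo_shift (r : R) (F : C -> C) (a : nat -> C) : 0 < r ->
  geo r F a -> geo r (fun z => z * F z)%C (shift a).
Proof.
intros Hr [[M HM] HF]; split.
- exists (M / r); intros [|n]; simpl.
  + rewrite Cmod_0; generalize (HM O) (Cmod_ge_0 (a O)); simpl; intros.
    rewrite Rmult_1_r; apply Rdiv_le_0_compat; lra.
  + replace (M / r * (r * r ^ n)) with (M * r ^ n) by (field; lra); apply HM.
- intros z Hz; apply Clim_incr.
  apply Clim_ext with (fun n => z * csum (fun k => a k * z ^ k)%C n)%C.
  + intros n; rewrite csum_shift; reflexivity.
  + apply Clim_scal, HF, Hz.
Qed.

Lemma one_minus_neq0 (q z : C) : Cmod q * Cmod z < 1 -> (1 - q * z)%C <> 0%C.
Proof.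
intros H E; assert (E' : (q * z)%C = RtoC 1).
{ replace (q * z)%C with (1 - (1 - q * z))%C by ring; rewrite E; ring. }
rewrite <- Cmod_mult, E', Cmod_1 in H; lra.
Qed.

(** The recurrence defining [gdiv] makes the product telescope up to one boundary term, which tends
    to 0 inside the disk of convergence. *)
Lemma csum_gdiv (q : C) (a : nat -> C) (z : C) (n : nat) :
  ((1 - q * z) * csum (fun k => gdiv q a k * z ^ k)%C (S n))%C
  = (csum (fun k => a k * z ^ k)%C (S n) - q * gdiv q a n * z ^ S n)%C.
Proof.
induction n as [|n IH]; [simpl; ring|].
change (csum (fun k => gdiv q a k * z ^ k)%C (S (S n)))
  with (csum (fun k => gdiv q a k * z ^ k) (S n) + gdiv q a (S n) * z ^ S n)%C.
rewrite Cmult_plus_distr_l, IH; simpl; ring.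
Qed.

Lemma geo_gdiv (r : R) (q : C) (F : C -> C) (a : nat -> C) : Cmod q < r ->
  geo r F a -> geo r (fun z => F z / (1 - q * z))%C (gdiv q a).
Proof.
intros Hq [[M HM] HF].
assert (Hq0 := Cmod_ge_0 q).
assert (M0 : 0 <= M) by (generalize (HM O) (Cmod_ge_0 (a O)); simpl; lra).
(* The constant is the sum of the geometric series M (|q|/r)^j, and it is the fixed point of the
   recurrence: C r = M r + |q| C. *)
assert (B : forall n, Cmod (gdiv q a n) <= M * r / (r - Cmod q) * r ^ n).
{ assert (E : M * r / (r - Cmod q) = M + Cmod q * M / (r - Cmod q)) by (field; lra).
  induction n as [|n IH].
  - simpl; apply Rle_trans with (1 := HM O).
    assert (0 <= Cmod q * M / (r - Cmod q)).
    { apply Rdiv_le_0_compat; [apply Rmult_le_pos|]; lra. }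
    simpl; lra.
  - simpl gdiv; apply Rle_trans with (1 := Cmod_triangle _ _); rewrite Cmod_mult.
    apply Rle_trans with (M * r ^ S n + Cmod q * (M * r / (r - Cmod q) * r ^ n)).
    + apply Rplus_le_compat; [apply HM | apply Rmult_le_compat_l; assumption].
    + right; simpl; field; lra. }
split; [eexists; exact B|].
intros z Hz.
assert (Hz0 := Cmod_ge_0 z).
assert (N0 : (1 - q * z)%C <> 0%C).
{ apply one_minus_neq0; apply Rle_lt_trans with (Cmod z * r); [|exact Hz].
  rewrite Rmult_comm; apply Rmult_le_compat_l; lra. }
apply Clim_incr.
apply Clim_ext with (fun n => / (1 - q * z) *
  (csum (fun k => a k * z ^ k) (S n) + (- q * z) * (gdiv q a n * z ^ n)))%C.
{ intros n.
  replace (csum (fun k => gdiv q a k * z ^ k)%C (S n)) with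
    (/ (1 - q * z) * ((1 - q * z) * csum (fun k => gdiv q a k * z ^ k) (S n)))%C
    by (rewrite Cmult_assoc, Cinv_l by exact N0; ring).
  rewrite csum_gdiv; simpl Cpow; f_equal; ring. }
replace (F z / (1 - q * z))%C with (/ (1 - q * z) * (F z + (- q * z) * 0))%C
  by (unfold Cdiv; ring).
apply Clim_scal, Clim_plus; [apply Clim_incr with (u := csum (fun k => a k * z ^ k)%C), HF, Hz|].
apply Clim_scal, (Clim_0 _ (M * r / (r - Cmod q)) (Cmod z * r)).
- split; [apply Rmult_le_pos; lra | exact Hz].
- apply term_bound, B.
Qed.

(** The point is uniformity: one constant serves the whole disk |z| <= x, hence all roots of unity
    on a circle at once. *)
Lemma geo_tail (r : R) (F : C -> C) (a : nat -> C) (x : R) : 0 < r -> 0 <= x -> x * r < 1 ->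
  geo r F a -> exists M, forall z N, Cmod z <= x ->
    Cmod (F z - csum (fun k => a k * z ^ k) N)%C <= M * (x * r) ^ N.
Proof.
intros Hr Hx Hxr [[M HM] HF]; exists (M * / (1 - x * r)); intros z N Hz.
assert (M0 : 0 <= M) by (generalize (HM O) (Cmod_ge_0 (a O)); simpl; lra).
assert (Hxr0 : 0 <= x * r) by (apply Rmult_le_pos; lra).
assert (Hzx : Cmod z * r <= x * r) by (apply Rmult_le_compat_r; lra).
assert (Hz0 : 0 <= Cmod z * r) by (apply Rmult_le_pos; [apply Cmod_ge_0 | lra]).
replace (M * / (1 - x * r) * (x * r) ^ N) with (M * (x * r) ^ N * / (1 - x * r)) by ring.
apply Clim_tail; [lra | | apply HF; lra].
intros k; apply Rle_trans with (1 := term_bound _ _ _ z HM k).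
apply Rmult_le_compat_l; [exact M0 | apply pow_incr; lra].
Qed.

(** * Roots of unity, discrete Parseval identity and Cauchy estimates *)

Definition cis (t : R) : C := (cos t, sin t).

Lemma cis_plus (s t : R) : cis (s + t) = (cis s * cis t)%C.
Proof.
apply injective_projections; simpl; [rewrite cos_plus | rewrite sin_plus]; ring.
Qed.

Lemma cis_pow (t : R) (n : nat) : (cis t ^ n)%C = cis (INR n * t).
Proof.
induction n as [|n IH].
- simpl; rewrite Rmult_0_l; unfold cis; rewrite cos_0, sin_0; reflexivity.
- rewrite S_INR; simpl; rewrite IH, <- cis_plus; f_equal; ring.
Qed.

Lemma Cmod_cis (t : R) : Cmod (cis t) = 1.
Proof.
unfold Cmod, cis; simpl.
replace (cos t * (cos t * 1) + sin t * (sin t * 1)) with ((sin t)² + (cos t)²)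
  by (unfold Rsqr; ring).
rewrite sin2_cos2; apply sqrt_1.
Qed.

Lemma cis_neq1 (t : R) : 0 < t < 2 * PI -> cis t <> RtoC 1.
Proof.
intros Ht E; apply (f_equal fst) in E; simpl in E.
replace t with (2 * (t / 2)) in E by field; rewrite cos_2a_sin in E.
assert (0 < sin (t / 2)) by (apply sin_gt_0; lra).
generalize (Rmult_lt_0_compat _ _ H H); lra.
Qed.

Lemma root_sum (z : C) (N : nat) : z <> RtoC 1 -> (z ^ N)%C = RtoC 1 ->
  csum (fun j => z ^ j)%C N = RtoC 0.
Proof.
intros H1 HN.
assert (E : ((z - 1) * csum (fun j => z ^ j) N)%C = (z ^ N - 1)%C).
{ clear; induction N as [|N IH]; simpl; [ring|].
  rewrite Cmult_plus_distr_l, IH; ring. }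
rewrite HN in E; replace (1 - 1)%C with (RtoC 0) in E by ring.
assert (H : (z - 1)%C <> RtoC 0) by (apply Cminus_eq_contra, H1).
destruct (classic (csum (fun j => z ^ j)%C N = RtoC 0)) as [|H0]; [assumption|].
destruct (Cmult_neq_0 _ _ H H0 E).
Qed.

Lemma csum_mult (u v : nat -> C) (m n : nat) :
  (csum u m * csum v n)%C = csum (fun i => csum (fun j => u i * v j)%C n) m.
Proof.
induction m as [|m IH]; simpl; [ring|].
rewrite Cmult_plus_distr_r, IH, csum_scal; reflexivity.
Qed.

Lemma unit_conj (z : C) : Cmod z = 1 -> (z * Cconj z)%C = RtoC 1.
Proof. intros H; rewrite <- Cmod2_conj, H; apply f_equal; ring. Qed.

(** Parseval for the discrete Fourier transform of length N: after expanding the squares,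
    orthogonality of the characters of the cyclic group kills every off-diagonal pair. *)
Lemma discrete_parseval (u : nat -> C) (N : nat) : (0 < N)%nat ->
  rsum (fun j => Cmod (csum (fun n => u n * (cis (2 * PI / INR N) ^ j) ^ n)%C N) ^ 2) N
  = INR N * rsum (fun n => Cmod (u n) ^ 2) N.
Proof.
intros HN; set (w := cis (2 * PI / INR N)).
assert (N0 : 0 < INR N) by (apply lt_0_INR, HN).
assert (W1 : (w * Cconj w)%C = RtoC 1) by apply unit_conj, Cmod_cis.
assert (WN : (w ^ N)%C = RtoC 1).
{ unfold w; rewrite cis_pow; replace (INR N * (2 * PI / INR N)) with (2 * PI) by (field; lra).
  unfold cis; rewrite cos_2PI, sin_2PI; reflexivity. }
assert (Wd : forall d, (0 < d < N)%nat -> (w ^ d)%C <> RtoC 1).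
{ intros d Hd; unfold w; rewrite cis_pow; apply cis_neq1.
  assert (HP := PI_RGT_0).
  assert (0 < INR d) by (apply lt_0_INR; lia).
  assert (INR d < INR N) by (apply lt_INR; lia).
  replace (INR d * (2 * PI / INR N)) with (2 * PI * (INR d / INR N)) by (field; lra).
  assert (0 < INR d / INR N) by (apply Rdiv_lt_0_compat; lra).
  assert (INR d / INR N < 1) by (apply Rlt_div_l; lra).
  split; [apply Rmult_lt_0_compat; lra|].
  rewrite <- (Rmult_1_r (2 * PI)) at 2; apply Rmult_lt_compat_l; lra. }
assert (Wp : forall m, (w ^ m * Cconj w ^ m)%C = RtoC 1).
{ intros m; rewrite <- Cpow_mult_l, W1; apply Cpow_1_l. }
assert (Wnm : forall n m, (n < N)%nat -> (m < N)%nat -> m <> n ->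
  (w ^ n * Cconj w ^ m)%C <> RtoC 1).
{ assert (Wlt : forall n m, (n < N)%nat -> (m < n)%nat ->
    (w ^ n * Cconj w ^ m)%C <> RtoC 1).
  { intros n m Hn Hm E; apply (Wd (n - m)%nat); [lia|].
    rewrite <- E; replace n with (n - m + m)%nat at 2 by lia.
    rewrite Cpow_add_r, <- Cmult_assoc, Wp; ring. }
  intros n m Hn Hm Hnm E; destruct (Nat.lt_ge_cases m n) as [L|L].
  - exact (Wlt _ _ Hn L E).
  (* Conjugation swaps the two factors and reduces to the case already treated, so no negative
     exponent appears. *)
  - apply (Wlt m n Hm ltac:(lia)).
    apply (f_equal Cconj) in E; rewrite Cmult_conj, !Cpow_conj, Cconj_conj in E.
    rewrite Cmult_comm, E; apply injective_projections; simpl; ring. }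
apply RtoC_inj; rewrite RtoC_mult, <- !csum_RtoC.
rewrite (csum_ext _ (fun j => csum (fun n => csum (fun m =>
  (u n * Cconj (u m)) * (w ^ n * Cconj w ^ m) ^ j)%C N) N)).
2:{ intros j _; rewrite Cmod2_conj.
  rewrite csum_conj, csum_mult; apply csum_ext; intros n _; apply csum_ext; intros m _.
  rewrite Cmult_conj, !Cpow_conj, Cpow_mult_l, <- !Cpow_mult_r.
  rewrite (Nat.mul_comm j n), (Nat.mul_comm j m); ring. }
(* With the sum over j innermost, each pair (n, m) carries a geometric sum of an N-th root of unity:
   N on the diagonal, 0 elsewhere. *)
rewrite csum_exchange, <- csum_scal; apply csum_ext; intros n Hn.
rewrite csum_exchange, (csum_single _ n); [| exact Hn |].
- rewrite csum_scal, Wp, (csum_ext _ (fun _ => RtoC 1)) by (intros; apply Cpow_1_l).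
  rewrite csum_RtoC, rsum_const, Rmult_1_r, <- Cmod2_conj; ring.
- intros m Hm Hmn; rewrite csum_scal, root_sum; [ring | auto |].
  rewrite Cpow_mult_l, <- !Cpow_mult_r, (Nat.mul_comm n), (Nat.mul_comm m), !Cpow_mult_r.
  rewrite <- Cpow_conj, WN, !Cpow_1_l.
  replace (Cconj 1) with (RtoC 1) by (apply injective_projections; simpl; ring).
  rewrite Cpow_1_l; ring.
Qed.

(* Subordination on a circle, read off on the N-th roots of unity as N grows. *)
Lemma parseval_le (r rho : R) (F K : C -> C) (a b : nat -> C) (B : R) :
  0 < r -> 0 <= rho -> rho * r < 1 -> geo r F a -> geo r K b ->
  (forall z, Cmod z = rho -> Cmod (F z) <= Cmod (K z)) ->
  (forall n, rsum (fun k => (Cmod (b k) * rho ^ k) ^ 2) n <= B) ->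
  forall n, rsum (fun k => (Cmod (a k) * rho ^ k) ^ 2) n <= B.
Proof.
intros Hr Hrho Hrr Ha Hb HFK HB n.
destruct (geo_tail r F a rho Hr Hrho Hrr Ha) as [M HM].
destruct (geo_tail r K b rho Hr Hrho Hrr Hb) as [M' HM'].
destruct Hb as [[D HD] _].
assert (y0 : 0 <= rho * r) by (apply Rmult_le_pos; lra).
set (y := rho * r) in *.
(* [E] bounds every partial sum of K on the circle and [t N] the two truncation errors together. So
   the truncations satisfy |P| <= |Q| + t, and |P|^2 exceeds |Q|^2 by at most 2 E t + t^2, uniformly
   over the N roots of unity. *)
set (E := D * / (1 - y)).
set (t := fun N => (M + M') * y ^ N).
assert (main : forall N, (0 < N)%nat ->
  rsum (fun k => (Cmod (a k) * rho ^ k) ^ 2) N <= B + 2 * E * t N + t N * t N).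
{ intros N HN.
  assert (N0 : 0 < INR N) by (apply lt_0_INR, HN).
  set (w := cis (2 * PI / INR N)).
  assert (conv : forall c : nat -> C,
    INR N * rsum (fun k => (Cmod (c k) * rho ^ k) ^ 2) N =
    rsum (fun j => Cmod (csum (fun k => c k * (rho * w ^ j) ^ k)%C N) ^ 2) N).
  { intros c; rewrite (rsum_ext _ (fun k => Cmod (c k * rho ^ k)%C ^ 2)).
    2:{ intros k _; rewrite Cmod_mult, Cmod_pow, Cmod_R, (Rabs_pos_eq _ Hrho); reflexivity. }
    rewrite <- discrete_parseval by exact HN.
    apply rsum_ext; intros j _; do 2 f_equal; apply csum_ext; intros k _.
    rewrite Cpow_mult_l; fold w; ring. }
  apply Rmult_le_reg_l with (INR N); [exact N0|].
  rewrite conv.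
  apply Rle_trans with (rsum (fun j => Cmod (csum (fun k => b k * (rho * w ^ j) ^ k)%C N) ^ 2
     + (2 * E * t N + t N * t N)) N).
  2:{ rewrite rsum_plus, <- conv, rsum_const.
      generalize (Rmult_le_compat_l _ _ _ (Rlt_le _ _ N0) (HB N)); lra. }
  apply rsum_le; intros j _.
  assert (HZ : Cmod (rho * w ^ j)%C = rho).
  { rewrite Cmod_mult, Cmod_pow; unfold w; rewrite Cmod_cis, pow1, Cmod_R, Rabs_pos_eq; lra. }
  set (z := (rho * w ^ j)%C) in *.
  set (P := csum (fun k => a k * z ^ k)%C N); set (Q := csum (fun k => b k * z ^ k)%C N).
  assert (HP : Cmod P <= Cmod Q + t N).
  { generalize (HM z N (Req_le _ _ HZ)) (HM' z N (Req_le _ _ HZ)) (HFK z HZ).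
    fold P; fold Q; intros A1 A2 A3.
    assert (B1 : Cmod P <= Cmod (F z) + Cmod (F z - P)%C).
    { replace P with (F z + - (F z - P))%C at 1 by ring.
      rewrite <- (Cmod_opp (F z - P)); apply Cmod_triangle. }
    assert (B2 : Cmod (K z) <= Cmod Q + Cmod (K z - Q)%C).
    { replace (K z) with (Q + (K z - Q))%C at 1 by ring; apply Cmod_triangle. }
    unfold t; lra. }
  assert (HQ : Cmod Q <= E).
  { assert (T := csum_tail (fun k => b k * z ^ k)%C D y 0 N (conj y0 Hrr)).
    simpl in T; fold Q in T; rewrite Rmult_1_r in T.
    replace (Q - 0)%C with Q in T by ring; apply T; [|lia].
    intros k; unfold y; rewrite <- HZ at 1; apply term_bound, HD. }
  generalize (Cmod_ge_0 P) (Cmod_ge_0 Q); intros P0 Q0.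
  assert (t0 : 0 <= t N).
  { unfold t; generalize (HM z N (Req_le _ _ HZ)) (HM' z N (Req_le _ _ HZ)).
    generalize (Cmod_ge_0 (F z - csum (fun k => a k * z ^ k) N)%C)
      (Cmod_ge_0 (K z - csum (fun k => b k * z ^ k) N)%C); lra. }
  apply Rle_trans with ((Cmod Q + t N) ^ 2); [apply pow_incr; lra|].
  generalize (Rmult_le_compat_r _ _ _ t0 HQ); simpl; lra. }
assert (L : is_lim_seq (fun N => B + 2 * E * t N + t N * t N) (B + 2 * E * 0 + 0 * 0)).
{ assert (T : is_lim_seq t 0) by (apply lim_geom; lra).
  apply is_lim_seq_plus'; [apply is_lim_seq_plus'|].
  - apply is_lim_seq_const.
  - apply is_lim_seq_mult'; [apply is_lim_seq_const | exact T].
  - apply is_lim_seq_mult'; exact T. }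
replace (B + 2 * E * 0 + 0 * 0) with B in L by ring.
apply (is_lim_seq_le_loc (fun _ => rsum (fun k => (Cmod (a k) * rho ^ k) ^ 2) n) _ _ _)
  with (2 := is_lim_seq_const _) (3 := L).
exists (S n); intros N HN; apply Rle_trans with (2 := main N ltac:(lia)).
apply rsum_mono; [intros; apply pow2_ge_0 | lia].
Qed.

(** Comparison with the constant function B, keeping a single term of the square sum. *)
Lemma cauchy_estimate (r rho : R) (F : C -> C) (a : nat -> C) (B : R) :
  0 < r -> 0 <= rho -> rho * r < 1 -> 0 <= B -> geo r F a ->
  (forall z, Cmod z = rho -> Cmod (F z) <= B) ->
  forall n, Cmod (a n) * rho ^ n <= B.
Proof.
intros Hr Hrho Hrr HB Ha H n.
apply Rsqr_incr_0_var; [|exact HB]; rewrite !Rsqr_pow2.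
apply Rle_trans with (rsum (fun k => (Cmod (a k) * rho ^ k) ^ 2) (S n)).
- apply (rsum_term (fun k => (Cmod (a k) * rho ^ k) ^ 2)); [intros; apply pow2_ge_0 | lia].
- apply (parseval_le r rho F (fun _ => RtoC B) a (delta B)); auto.
  + apply geo_const, Hr.
  + intros z Hz; rewrite Cmod_R, Rabs_pos_eq; auto.
  + intros m; destruct m as [|m]; [apply pow2_ge_0|].
    apply Rle_trans with (rsum (fun k => (Cmod (delta B k) * rho ^ k) ^ 2) 1).
    * clear; induction m as [|m IH]; [lra|].
      apply Rle_trans with (2 := IH).
      change (rsum (fun k => (Cmod (delta B k) * rho ^ k) ^ 2) (S m)
        + (Cmod (delta B (S m)) * rho ^ S m) ^ 2
        <= rsum (fun k => (Cmod (delta B k) * rho ^ k) ^ 2) (S m)).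
      change (delta B (S m)) with (RtoC 0); rewrite Cmod_0; lra.
    * simpl; rewrite Cmod_R, Rabs_pos_eq by lra; lra.
Qed.

(** * Norm and coefficients in the weighted Dirichlet space *)

(** Take 1 + ln y <= y at y = e (n+1) and multiply by A. The choice e = ln s / A turns the right
    side into (n+1) ln s, and K collects the terms free of n. The summand 1 in A keeps it positive
    when nu = 0. *)
Lemma weight_le_geom (nu s : R) : 1 < s ->
  exists K, 0 < K /\ forall n, weight nu n <= K * s ^ n.
Proof.
intros Hs.
set (A := 2 * Rabs nu + 1).
assert (HA : 0 < A) by (generalize (Rabs_pos nu); unfold A; lra).
assert (Ls : 0 < ln s) by (rewrite <- ln_1; apply ln_increasing; lra).
set (e := ln s / A).
assert (He : 0 < e) by (apply Rdiv_lt_0_compat; assumption).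
exists (exp (ln s - A - A * ln e)); split; [apply exp_pos|].
intros n; rewrite <- Rpower_pow by lra; unfold weight, Rpower; rewrite <- exp_plus.
assert (Hn : 1 <= INR (n + 1)) by (apply (le_INR 1); lia).
assert (Hl : 0 <= ln (INR (n + 1))) by (rewrite <- ln_1; apply ln_le; lra).
assert (H1 : 2 * nu * ln (INR (n + 1)) <= A * ln (INR (n + 1))).
{ apply Rmult_le_compat_r; [exact Hl|]; generalize (Rle_abs nu) (Rabs_pos nu); unfold A; lra. }
assert (H2 : 1 + ln (e * INR (n + 1)) <= e * INR (n + 1)).
{ apply Rle_trans with (1 := exp_ineq1_le _); right; apply exp_ln.
  apply Rmult_lt_0_compat; lra. }
rewrite ln_mult in H2 by lra.
apply (Rmult_le_compat_l A) in H2; [|lra].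
assert (H3 : A * (e * INR (n + 1)) = ln s + INR n * ln s).
{ rewrite plus_INR; unfold e; simpl; field; lra. }
assert (H4 : 2 * nu * ln (INR (n + 1)) <= ln s - A - A * ln e + INR n * ln s) by lra.
destruct H4 as [H4|H4]; [left; apply exp_increasing, H4 | right; rewrite H4; reflexivity].
Qed.

Lemma weight_opp (nu : R) (n : nat) : weight nu n * weight (- nu) n = 1.
Proof.
unfold weight; rewrite <- Rpower_plus.
replace (2 * nu + 2 * - nu) with 0 by ring; apply Rpower_O.
apply lt_0_INR; lia.
Qed.

Lemma wsq_le_dnorm (nu : R) (f : dirichlet nu) (n : nat) :
  wsq nu (taylor f) n <= dnorm f ^ 2.
Proof.
rewrite <- dnorm_sq; apply Rle_trans with (rsum (wsq nu (taylor f)) (S n)).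
- apply rsum_term; [apply wsq_ge0 | lia].
- apply rsum_le_Series; [apply wsq_ge0 | apply taylor_sq].
Qed.

Lemma taylor_bound (nu s : R) : 1 < s -> exists K, 0 < K /\
  forall (f : dirichlet nu) n, Cmod (taylor f n) <= K * dnorm f * s ^ n.
Proof.
intros Hs; destruct (weight_le_geom (- nu) (s * s)) as [K [HK HW]].
{ generalize (Rmult_lt_compat_l s _ _ ltac:(lra) Hs); lra. }
(* After squaring, only K <= (1+K)^2 is needed, so 1 + K stands in for the square root of K. *)
exists (1 + K); split; [lra|]; intros f n.
assert (H0 := dnorm_ge0 nu f).
assert (Hsn : 0 <= s ^ n) by (apply pow_le; lra).
apply Rsqr_incr_0_var; [|apply Rmult_le_pos; [apply Rmult_le_pos|]; lra].
rewrite !Rsqr_pow2.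
apply Rle_trans with (wsq nu (taylor f) n * weight (- nu) n).
{ right; unfold wsq; rewrite Rmult_assoc, weight_opp; ring. }
apply Rle_trans with (dnorm f ^ 2 * (K * (s * s) ^ n)).
{ apply Rmult_le_compat; [apply wsq_ge0 | apply Rlt_le, weight_pos | apply wsq_le_dnorm | apply HW]. }
rewrite !Rpow_mult_distr, <- Rpow_mult_distr.
replace ((1 + K) ^ 2 * dnorm f ^ 2 * (s ^ n) ^ 2) with (dnorm f ^ 2 * ((1 + K) ^ 2 * (s * s) ^ n))
  by (rewrite Rpow_mult_distr; ring).
apply Rmult_le_compat_l; [apply pow2_ge_0|].
apply Rmult_le_compat_r; [apply pow_le; generalize (Rmult_lt_0_compat s s); lra|].
generalize (pow2_ge_0 K); lra.
Qed.

Lemma wsq_geom (nu x : R) : 0 <= x < 1 -> exists K, 0 <= K /\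
  forall (a : nat -> C) M, (forall n, Cmod (a n) <= M * x ^ n) ->
    forall n, rsum (wsq nu a) n <= K * M ^ 2.
Proof.
intros Hx.
(* A ratio with 1 < s and x^2 s < 1 that also makes sense at x = 0. *)
set (s := 2 / (1 + x ^ 2)).
assert (Hx2 : 0 <= x ^ 2 < 1).
{ split; [apply pow2_ge_0|]; generalize (Rmult_le_compat_l x x 1); simpl; lra. }
assert (Hs : 1 < s) by (unfold s; apply Rlt_div_r; lra).
assert (Hxs : x ^ 2 * s < 1).
{ unfold s; replace (x ^ 2 * (2 / (1 + x ^ 2))) with ((2 * x ^ 2) / (1 + x ^ 2)) by (field; lra).
  apply Rlt_div_l; lra. }
assert (Hxs0 : 0 <= x ^ 2 * s) by (apply Rmult_le_pos; lra).
destruct (weight_le_geom nu s Hs) as [K [HK HW]].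
exists (K * / (1 - x ^ 2 * s)); split.
{ apply Rmult_le_pos; [lra | apply Rlt_le, Rinv_0_lt_compat; lra]. }
intros a M Ha n.
apply Rle_trans with (rsum (fun k => K * M ^ 2 * (x ^ 2 * s) ^ k) n).
- apply rsum_le; intros k _; unfold wsq.
  apply Rle_trans with ((M * x ^ k) ^ 2 * (K * s ^ k)).
  + apply Rmult_le_compat; [apply pow2_ge_0 | apply Rlt_le, weight_pos | | apply HW].
    apply pow_incr; split; [apply Cmod_ge_0 | apply Ha].
  + right; rewrite (Rpow_mult_distr (x ^ 2)), <- (pow_mult x 2), Nat.mul_comm, pow_mult; ring.
- rewrite rsum_scal.
  replace (K * / (1 - x ^ 2 * s) * M ^ 2) with (K * M ^ 2 * / (1 - x ^ 2 * s)) by ring.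
  apply Rmult_le_compat_l; [apply Rmult_le_pos; [lra | apply pow2_ge_0]|].
  apply rsum_geom; lra.
Qed.

Lemma dnorm_le_rsum (nu : R) (f : dirichlet nu) (B : R) : 0 <= B ->
  (forall n, rsum (wsq nu (taylor f)) n <= B ^ 2) -> dnorm f <= B.
Proof.
intros HB H; unfold dnorm; rewrite <- (sqrt_pow2 B HB).
apply sqrt_le_1_alt, (series_bounded (wsq nu (taylor f))); [apply wsq_ge0 | exact H].
Qed.

Lemma dnorm_geom (nu x : R) : 0 <= x < 1 -> exists K, 0 <= K /\
  forall (f : dirichlet nu) M, 0 <= M ->
    (forall n, Cmod (taylor f n) <= M * x ^ n) -> dnorm f <= K * M.
Proof.
intros Hx; destruct (wsq_geom nu x Hx) as [K [HK H]].
exists (1 + K); split; [lra|]; intros f M HM Hf.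
apply dnorm_le_rsum; [apply Rmult_le_pos; lra|].
intros n; apply Rle_trans with (1 := H _ _ Hf n).
rewrite Rpow_mult_distr; apply Rmult_le_compat_r; [apply pow2_ge_0|].
generalize (pow2_ge_0 K); lra.
Qed.

(** The source of the concrete elements used below: the constant 1, the coordinate, powers of
    [mob p] and polynomials. *)
Lemma dirichlet_of_geo (nu r : R) (F : C -> C) (a : nat -> C) :
  0 < r < 1 -> geo r F a ->
  exists f : dirichlet nu, (forall z : disk, f z = F z) /\ forall n, taylor f n = a n.
Proof.
intros Hr [[M HM] HF].
assert (H1 : forall z : disk, @is_pseries C_AbsRing C_NormedModule a (z : C) (F z)).
{ intros z; apply is_pseries_Clim, HF.
  generalize (disk_lt1 z) (Cmod_ge_0 z); intros.
  apply Rle_lt_trans with (Cmod z * 1); [apply Rmult_le_compat_l|]; lra. }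
assert (H2 : ex_series (wsq nu a)).
{ destruct (wsq_geom nu r ltac:(lra)) as [K [HK H]].
  apply (series_bounded (wsq nu a) (K * M ^ 2)); [apply wsq_ge0 | apply H, HM]. }
exists (Dirichlet (fun z : disk => F z) a H1 H2); split; reflexivity.
Qed.

(* Junk value 0 off the disk. *)
Definition extend (f : disk -> C) (z : C) : C :=
  match Rlt_dec (Cmod z) 1 with left H => f (Disk z H) | right _ => 0%C end.

Lemma extend_disk (f : disk -> C) (z : disk) : extend f z = f z.
Proof.
unfold extend; destruct (Rlt_dec (Cmod z) 1) as [H|H].
- f_equal; apply disk_eq; reflexivity.
- destruct H; apply disk_lt1.
Qed.

Lemma dirichlet_geo (nu s : R) (f : dirichlet nu) : 1 < s -> geo s (extend f) (taylor f).
Proof.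
intros Hs; split.
- destruct (taylor_bound nu s Hs) as [K [_ HK]]; exists (K * dnorm f); apply HK.
- intros z Hz; assert (Hz1 : Cmod z < 1).
  { apply Rle_lt_trans with (2 := Hz); generalize (Cmod_ge_0 z); intros.
    rewrite <- (Rmult_1_r (Cmod z)) at 1; apply Rmult_le_compat_l; lra. }
  change (extend f z) with (extend f (disk_val (Disk z Hz1))); rewrite extend_disk; apply is_pseries_Clim.
  apply (taylor_sum f (Disk z Hz1)).
Qed.

Lemma radius_gap (x : R) : 0 <= x < 1 -> exists s, 1 < s /\ x * s < 1.
Proof.
intros Hx; exists (2 / (1 + x)); split.
- apply Rlt_div_r; lra.
- replace (x * (2 / (1 + x))) with ((2 * x) / (1 + x)) by (field; lra).
  apply Rlt_div_l; lra.
Qed.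

Lemma point_eval_bound (nu : R) (z : disk) :
  exists K, 0 <= K /\ forall f : dirichlet nu, Cmod (f z) <= K * dnorm f.
Proof.
destruct (radius_gap (Cmod z)) as [s [Hs Hzs]]; [split; [apply Cmod_ge_0 | apply disk_lt1]|].
destruct (taylor_bound nu s Hs) as [K [HK H]].
assert (H0 : 0 <= Cmod z * s) by (apply Rmult_le_pos; [apply Cmod_ge_0 | lra]).
exists (K * / (1 - Cmod z * s)); split.
{ apply Rmult_le_pos; [lra | apply Rlt_le, Rinv_0_lt_compat; lra]. }
intros f.
assert (T := Clim_tail _ (f z) (K * dnorm f) (Cmod z * s) 0 (conj H0 Hzs)
  (term_bound s _ _ z (H f)) (proj1 (is_pseries_Clim _ _ _) (taylor_sum f z))).
simpl in T; replace (f z - 0)%C with (f z) in T by ring.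
apply Rle_trans with (1 := T); right; ring.
Qed.

(** * Derivatives of functions on the disk *)

(** Derivative of a function that exists only on [disk], stated without any extension; uniqueness
    holds because p is an interior point. *)
Definition hasder (F : disk -> C) (p : disk) (d : C) : Prop :=
  forall e, 0 < e -> exists del, 0 < del /\ forall z : disk,
    Cmod (z - p)%C < del -> Cmod (F z - F p - d * (z - p))%C <= e * Cmod (z - p)%C.

Lemma hasder_ext (F G : disk -> C) (p : disk) (d : C) :
  (forall z, F z = G z) -> hasder F p d -> hasder G p d.
Proof.
intros E H e He; destruct (H e He) as [del [Hd H']]; exists del; split; [exact Hd|].
intros z Hz; rewrite <- !E; apply H', Hz.
Qed.

Lemma disk_near (p : disk) (del : R) : 0 < del ->
  exists z : disk, 0 < Cmod (z - p)%C < del.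
Proof.
intros Hd; set (t := Rmin (del / 2) ((1 - Cmod p) / 2)).
assert (Hp := disk_lt1 p).
assert (Ht : 0 < t) by (apply Rmin_pos; lra).
assert (Hz : Cmod (p + t)%C < 1).
{ apply Rle_lt_trans with (1 := Cmod_triangle _ _).
  rewrite Cmod_R, Rabs_pos_eq by lra.
  generalize (Rmin_r (del / 2) ((1 - Cmod p) / 2)); fold t; lra. }
exists (Disk _ Hz); simpl; replace (p + t - p)%C with (RtoC t) by ring.
rewrite Cmod_R, Rabs_pos_eq by lra.
generalize (Rmin_l (del / 2) ((1 - Cmod p) / 2)); fold t; lra.
Qed.

Lemma hasder_unique (F : disk -> C) (p : disk) (d d' : C) :
  hasder F p d -> hasder F p d' -> d = d'.
Proof.
intros H H'; apply (proj2 (Ceq_minus _ _)), Cmod_eq_0.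
apply Rle_antisym; [|apply Cmod_ge_0].
apply le_epsilon; intros e He; rewrite Rplus_0_l.
destruct (H (e / 2) ltac:(lra)) as [u [Hu A]], (H' (e / 2) ltac:(lra)) as [v [Hv B]].
destruct (disk_near p (Rmin u v) (Rmin_pos _ _ Hu Hv)) as [z [Hz0 Hz]].
specialize (A z (Rlt_le_trans _ _ _ Hz (Rmin_l _ _))).
specialize (B z (Rlt_le_trans _ _ _ Hz (Rmin_r _ _))).
apply Rmult_le_reg_r with (Cmod (z - p)%C); [exact Hz0|].
rewrite <- Cmod_mult.
replace ((d - d') * (z - p))%C with
  ((F z - F p - d' * (z - p)) + - (F z - F p - d * (z - p)))%C by ring.
apply Rle_trans with (1 := Cmod_triangle _ _); rewrite Cmod_opp; lra.
Qed.

Lemma hasder_quadratic (F : disk -> C) (p : disk) (d : C) (K del : R) : 0 < del ->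
  (forall z : disk, Cmod (z - p)%C < del ->
    Cmod (F z - F p - d * (z - p))%C <= K * Cmod (z - p)%C ^ 2) ->
  hasder F p d.
Proof.
intros Hd H e He.
assert (HK : 0 < Rabs K + 1) by (generalize (Rabs_pos K); lra).
exists (Rmin del (e / (Rabs K + 1))); split.
{ apply Rmin_pos; [exact Hd | apply Rdiv_lt_0_compat; assumption]. }
intros z Hz.
apply Rle_trans with (1 := H z (Rlt_le_trans _ _ _ Hz (Rmin_l _ _))).
assert (Hz2 := Rlt_le_trans _ _ _ Hz (Rmin_r _ _)).
assert (Hz0 := Cmod_ge_0 (z - p)%C).
apply Rlt_div_r in Hz2; [|lra].
simpl; rewrite Rmult_1_r, <- Rmult_assoc; apply Rmult_le_compat_r; [exact Hz0|].
generalize (Rmult_le_compat_r _ _ _ Hz0 (Rle_abs K)); lra.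
Qed.

Lemma hasder_const (c : C) (p : disk) : hasder (fun _ => c) p 0%C.
Proof.
apply hasder_quadratic with 0 1; [lra|]; intros z _.
replace (c - c - 0 * (z - p))%C with (RtoC 0) by ring; rewrite Cmod_0; lra.
Qed.

Lemma hasder_id (p : disk) : hasder (fun z => z) p 1%C.
Proof.
apply hasder_quadratic with 0 1; [lra|]; intros z _.
replace (z - p - 1 * (z - p))%C with (RtoC 0) by ring; rewrite Cmod_0; lra.
Qed.

Lemma hasder_plus (F G : disk -> C) (p : disk) (d d' : C) :
  hasder F p d -> hasder G p d' -> hasder (fun z => F z + G z)%C p (d + d')%C.
Proof.
intros H H' e He.
destruct (H (e / 2) ltac:(lra)) as [u [Hu A]], (H' (e / 2) ltac:(lra)) as [v [Hv B]].
exists (Rmin u v); split; [apply Rmin_pos; assumption|]; intros z Hz.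
specialize (A z (Rlt_le_trans _ _ _ Hz (Rmin_l _ _))).
specialize (B z (Rlt_le_trans _ _ _ Hz (Rmin_r _ _))).
replace (F z + G z - (F p + G p) - (d + d') * (z - p))%C with
  ((F z - F p - d * (z - p)) + (G z - G p - d' * (z - p)))%C by ring.
apply Rle_trans with (1 := Cmod_triangle _ _); lra.
Qed.

Lemma hasder_lipschitz (F : disk -> C) (p : disk) (d : C) : hasder F p d ->
  exists del, 0 < del /\ forall z : disk, Cmod (z - p)%C < del ->
    Cmod (F z - F p)%C <= (Cmod d + 1) * Cmod (z - p)%C.
Proof.
intros H; destruct (H 1 Rlt_0_1) as [u [Hu A]]; exists u; split; [exact Hu|].
intros z Hz; specialize (A z Hz).
replace (F z - F p)%C with ((F z - F p - d * (z - p)) + d * (z - p))%C by ring.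
apply Rle_trans with (1 := Cmod_triangle _ _); rewrite Cmod_mult; lra.
Qed.

Lemma hasder_scal (c : C) (F : disk -> C) (p : disk) (d : C) :
  hasder F p d -> hasder (fun z => c * F z)%C p (c * d)%C.
Proof.
intros H e He.
assert (Hc : 0 < Cmod c + 1) by (generalize (Cmod_ge_0 c); lra).
destruct (H (e / (Cmod c + 1))) as [u [Hu A]]; [apply Rdiv_lt_0_compat; assumption|].
exists u; split; [exact Hu|]; intros z Hz; specialize (A z Hz).
replace (c * F z - c * F p - c * d * (z - p))%C
  with (c * (F z - F p - d * (z - p)))%C by ring.
rewrite Cmod_mult.
apply Rle_trans with ((Cmod c + 1) * (e / (Cmod c + 1) * Cmod (z - p)%C)).
- apply Rmult_le_compat; try apply Cmod_ge_0; [lra | exact A].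
- right; field; lra.
Qed.

(** The product (F - F(p)) (G - G(p)) is of second order at p, and F G differs from it by an affine
    combination of F and G. *)
Lemma hasder_mult (F G : disk -> C) (p : disk) (d d' : C) :
  hasder F p d -> hasder G p d' ->
  hasder (fun z => F z * G z)%C p (d * G p + F p * d')%C.
Proof.
intros H H'.
assert (Q : hasder (fun z => (F z - F p) * (G z - G p))%C p 0%C).
{ destruct (hasder_lipschitz _ _ _ H) as [u [Hu A]], (hasder_lipschitz _ _ _ H') as [v [Hv B]].
  apply hasder_quadratic with ((Cmod d + 1) * (Cmod d' + 1)) (Rmin u v);
    [apply Rmin_pos; assumption|].
  intros z Hz.
  specialize (A z (Rlt_le_trans _ _ _ Hz (Rmin_l _ _))).
  specialize (B z (Rlt_le_trans _ _ _ Hz (Rmin_r _ _))).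
  replace ((F z - F p) * (G z - G p) - (F p - F p) * (G p - G p) - 0 * (z - p))%C
    with ((F z - F p) * (G z - G p))%C by ring.
  rewrite Cmod_mult.
  apply Rle_trans with (((Cmod d + 1) * Cmod (z - p)%C) * ((Cmod d' + 1) * Cmod (z - p)%C)).
  - apply Rmult_le_compat; try apply Cmod_ge_0; assumption.
  - right; ring. }
replace (d * G p + F p * d')%C with (0 + (G p * d + (F p * d' + 0)))%C by ring.
apply hasder_ext with (fun z => (F z - F p) * (G z - G p) + (G p * F z + (F p * G z + - (F p * G p))))%C.
{ intros z; ring. }
apply hasder_plus; [exact Q|]; apply hasder_plus; [apply hasder_scal, H|].
apply hasder_plus; [apply hasder_scal, H' | apply hasder_const].
Qed.

Lemma hasder_comp (F : disk -> C) (phi : disk -> disk) (p : disk) (d k : C) :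
  phi p = p -> hasder F p d -> hasder (fun z => phi z : C) p k ->
  hasder (fun z => F (phi z)) p (d * k)%C.
Proof.
intros Ep HF Hphi.
set (G := fun z => (F (phi z) - F p - d * (phi z - p))%C).
assert (HG : hasder G p 0%C).
{ destruct (hasder_lipschitz _ _ _ Hphi) as [u [Hu A]]; rewrite Ep in A.
  assert (Hk : 0 < Cmod k + 1) by (generalize (Cmod_ge_0 k); lra).
  intros e He; destruct (HF (e / (Cmod k + 1))) as [v [Hv B]]; [apply Rdiv_lt_0_compat; assumption|].
  exists (Rmin u (v / (Cmod k + 1))); split.
  { apply Rmin_pos; [|apply Rdiv_lt_0_compat]; assumption. }
  intros z Hz.
  specialize (A z (Rlt_le_trans _ _ _ Hz (Rmin_l _ _))).
  assert (Hz2 := Rlt_le_trans _ _ _ Hz (Rmin_r _ _)); apply Rlt_div_r in Hz2; [|exact Hk].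
  unfold G; rewrite Ep.
  replace (F (phi z) - F p - d * (phi z - p) - (F p - F p - d * (p - p)) - 0 * (z - p))%C
    with (F (phi z) - F p - d * (phi z - p))%C by ring.
  apply Rle_trans with (1 := B (phi z) ltac:(lra)).
  apply Rle_trans with (e / (Cmod k + 1) * ((Cmod k + 1) * Cmod (z - p)%C)).
  - apply Rmult_le_compat_l; [apply Rlt_le, Rdiv_lt_0_compat|]; assumption.
  - right; field; lra. }
replace (d * k)%C with (0 + (d * k + 0))%C by ring.
apply hasder_ext with (fun z => G z + (d * phi z + (F p - d * p)))%C.
{ intros z; unfold G; ring. }
apply hasder_plus; [exact HG|]; apply hasder_plus; [apply hasder_scal, Hphi | apply hasder_const].
Qed.

(* n p^(n-1), written without a predecessor. *)
Fixpoint dpow (p : C) (n : nat) : C :=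
  match n with O => 0%C | S m => (p ^ m + p * dpow p m)%C end.

Lemma dpow_bound (p : C) (rho sig : R) (n : nat) : Cmod p <= rho < sig ->
  Cmod (dpow p n) <= / (sig - rho) * sig ^ n.
Proof.
intros H; assert (H0 := Cmod_ge_0 p).
assert (Hi : 0 < / (sig - rho)) by (apply Rinv_0_lt_compat; lra).
induction n as [|n IH]; simpl; [rewrite Cmod_0; lra|].
apply Rle_trans with (1 := Cmod_triangle _ _); rewrite Cmod_pow, Cmod_mult.
apply Rle_trans with (sig ^ n + rho * (/ (sig - rho) * sig ^ n)).
- apply Rplus_le_compat; [apply pow_incr; lra|].
  apply Rmult_le_compat; try apply Cmod_ge_0; [lra | exact IH].
- right; field; lra.
Qed.

(** The gap between rho and sig absorbs the polynomial factors in n: with i = 1/(sig - rho), one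
    induction step is rho i^2 + i = i^2 sig. *)
Lemma pow_taylor (p z : C) (rho sig : R) (n : nat) : Cmod p <= rho < sig -> Cmod z <= rho ->
  Cmod (z ^ n - p ^ n - dpow p n * (z - p))%C
    <= (/ (sig - rho)) ^ 2 * sig ^ n * Cmod (z - p)%C ^ 2.
Proof.
intros Hp Hz.
assert (Hi : 0 < / (sig - rho)) by (apply Rinv_0_lt_compat; lra).
assert (H0 := Cmod_ge_0 p).
induction n as [|n IH].
- simpl; replace (1 - 1 - 0 * (z - p))%C with (RtoC 0) by ring; rewrite Cmod_0.
  repeat apply Rmult_le_pos; try apply Cmod_ge_0; lra.
- replace (z ^ S n - p ^ S n - dpow p (S n) * (z - p))%C with
    (z * (z ^ n - p ^ n - dpow p n * (z - p)) + dpow p n * (z - p) ^ 2)%C by (simpl; ring).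
  apply Rle_trans with (1 := Cmod_triangle _ _); rewrite !Cmod_mult, Cmod_pow.
  apply Rle_trans with (rho * ((/ (sig - rho)) ^ 2 * sig ^ n * Cmod (z - p)%C ^ 2)
    + / (sig - rho) * sig ^ n * Cmod (z - p)%C ^ 2).
  + apply Rplus_le_compat.
    * apply Rmult_le_compat; try apply Cmod_ge_0; assumption.
    * apply Rmult_le_compat_r; [apply pow2_ge_0 | apply dpow_bound, Hp].
  + right; simpl; field; lra.
Qed.

Lemma geo_derivative (s rho sig M : R) (F : C -> C) (a : nat -> C) (p : C) :
  0 < s -> Cmod p <= rho < sig -> sig * s < 1 ->
  (forall n, Cmod (a n) <= M * s ^ n) -> geo s F a ->
  exists d, Clim (csum (fun k => a k * dpow p k)%C) d /\
    Cmod d <= M * / (sig - rho) * / (1 - sig * s) /\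
    forall z, Cmod z <= rho ->
      Cmod (F z - F p - d * (z - p))%C
        <= M * (/ (sig - rho)) ^ 2 * / (1 - sig * s) * Cmod (z - p)%C ^ 2.
Proof.
intros Hs Hp Hss HM [_ HF].
assert (H0 := Cmod_ge_0 p).
assert (Hx : 0 <= sig * s < 1) by (split; [apply Rmult_le_pos|]; lra).
assert (B : forall k, Cmod (a k * dpow p k)%C <= M * / (sig - rho) * (sig * s) ^ k).
{ intros k; rewrite Cmod_mult.
  apply Rle_trans with ((M * s ^ k) * (/ (sig - rho) * sig ^ k)).
  - apply Rmult_le_compat; try apply Cmod_ge_0; [apply HM | apply dpow_bound, Hp].
  - right; rewrite Rpow_mult_distr; ring. }
destruct (series_complete _ _ _ Hx B) as [d Hd]; exists d; split; [exact Hd|].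
split.
- assert (T := Clim_tail _ d _ _ 0 Hx B Hd); simpl in T.
  rewrite Rmult_1_r in T; replace (d - 0)%C with d in T by ring; exact T.
- intros z Hz.
  assert (Hin : forall w, Cmod w <= rho -> Cmod w * s < 1).
  { intros w Hw; apply Rle_lt_trans with (2 := Hss); apply Rmult_le_compat_r; lra. }
  assert (L : Clim (csum (fun k => a k * (z ^ k - p ^ k - dpow p k * (z - p)))%C)
    (F z + ((-1) * F p + (- (z - p)) * d))%C).
  { apply Clim_ext with (fun n => csum (fun k => a k * z ^ k)%C n +
      ((-1) * csum (fun k => a k * p ^ k)%C n + (- (z - p)) * csum (fun k => a k * dpow p k)%C n))%C.
    - intros n; rewrite <- !csum_scal, <- !csum_plus; apply csum_ext; intros; ring.
    - apply Clim_plus; [apply HF, Hin, Hz|].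
      apply Clim_plus; apply Clim_scal; [apply HF, Hin; lra | exact Hd]. }
  replace (F z - F p - d * (z - p))%C with (F z + ((-1) * F p + (- (z - p)) * d) - 0)%C by ring.
  assert (B2 : forall k, Cmod (a k * (z ^ k - p ^ k - dpow p k * (z - p)))%C
    <= M * (/ (sig - rho)) ^ 2 * Cmod (z - p)%C ^ 2 * (sig * s) ^ k).
  { intros k; rewrite Cmod_mult.
    apply Rle_trans with ((M * s ^ k) * ((/ (sig - rho)) ^ 2 * sig ^ k * Cmod (z - p)%C ^ 2)).
    - apply Rmult_le_compat; try apply Cmod_ge_0; [apply HM | apply pow_taylor; assumption].
    - right; rewrite Rpow_mult_distr; ring. }
  assert (T := Clim_tail _ _ _ _ 0 Hx B2 L); simpl csum in T.
  rewrite pow_O in T; apply Rle_trans with (1 := T); right; ring.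
Qed.

(** [K] is chosen before the function, which is what makes differentiation at p a bounded
    functional. *)
Lemma geo_hasder (s : R) (p : disk) : 0 < s -> Cmod p * s < 1 -> exists K,
  forall (f : disk -> C) (F : C -> C) (a : nat -> C) (M : R),
    (forall z : disk, f z = F z) -> geo s F a -> (forall n, Cmod (a n) <= M * s ^ n) ->
    exists d, Clim (csum (fun k => a k * dpow p k)%C) d /\ hasder f p d /\ Cmod d <= M * K.
Proof.
intros Hs Hps.
(* A third of the available room, so that both radii |p| + h and |p| + 2h stay below 1/s. *)
set (h := (/ s - Cmod p) / 3).
assert (Hh : 0 < h).
{ assert (Cmod p < / s); [|unfold h; lra].
  apply Rmult_lt_reg_r with s; [exact Hs|]; rewrite Rinv_l; lra. }
assert (Hsig : (Cmod p + 2 * h) * s < 1).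
{ apply Rlt_le_trans with (/ s * s); [|rewrite Rinv_l; lra].
  apply Rmult_lt_compat_r; [exact Hs|]; unfold h; unfold h in Hh; lra. }
exists (/ (Cmod p + 2 * h - (Cmod p + h)) * / (1 - (Cmod p + 2 * h) * s)).
intros f F a M E HG HM.
destruct (geo_derivative s (Cmod p + h) (Cmod p + 2 * h) M F a p) as [d [H1 [H2 H3]]];
  try assumption; [lra|].
exists d; split; [exact H1|]; split; [|rewrite <- Rmult_assoc; exact H2].
eapply hasder_quadratic with (del := h); [exact Hh|].
intros z Hz; rewrite !E; apply H3.
replace (z : C) with (p + (z - p))%C by ring.
apply Rle_trans with (1 := Cmod_triangle _ _); lra.
Qed.

Lemma dirichlet_hasder (nu : R) (p : disk) : exists K, 0 <= K /\
  forall f : dirichlet nu, exists d, hasder f p d /\ Cmod d <= K * dnorm f.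
Proof.
destruct (radius_gap (Cmod p)) as [s [Hs Hps]]; [split; [apply Cmod_ge_0 | apply disk_lt1]|].
destruct (geo_hasder s p ltac:(lra) Hps) as [K HK].
destruct (taylor_bound nu s Hs) as [K' [HK' H]].
exists (K' * Rabs K); split; [apply Rmult_le_pos; [lra | apply Rabs_pos]|].
intros f; destruct (HK f (extend f) (taylor f) (K' * dnorm f)) as [d [_ [H1 H2]]].
- intros z; symmetry; apply extend_disk.
- apply dirichlet_geo, Hs.
- apply H.
- exists d; split; [exact H1|].
  apply Rle_trans with (1 := H2); replace (K' * Rabs K * dnorm f) with (K' * dnorm f * Rabs K) by ring.
  apply Rmult_le_compat_l; [|apply Rle_abs].
  apply Rmult_le_pos; [lra | apply dnorm_ge0].
Qed.

(** * Disk automorphisms *)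

Definition mob (p z : C) : C := ((z - p) / (1 - Cconj p * z))%C.

(** One identity for both uses: [mob p] maps the disk into itself, and is unimodular on the unit
    circle, where the right side vanishes. *)
Lemma mob_identity (p z : C) :
  Cmod (1 - Cconj p * z)%C ^ 2 - Cmod (z - p)%C ^ 2 = (1 - Cmod z ^ 2) * (1 - Cmod p ^ 2).
Proof.
apply RtoC_inj.
rewrite RtoC_mult, !RtoC_minus, !Cmod2_conj, !Cminus_conj, Cmult_conj, Cconj_conj.
replace (Cconj 1) with (RtoC 1) by (apply injective_projections; simpl; ring).
ring.
Qed.

Lemma mob_denom (p z : C) : Cmod p < 1 -> Cmod z <= 1 -> (1 - Cconj p * z)%C <> RtoC 0.
Proof.
intros Hp Hz; apply one_minus_neq0; rewrite Cmod_conj.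
apply Rle_lt_trans with (Cmod p * 1); [apply Rmult_le_compat_l; [apply Cmod_ge_0|]|]; lra.
Qed.

Lemma Cmod_sqr_lt1 (p : C) : Cmod p < 1 -> Cmod p ^ 2 < 1.
Proof.
intros H; generalize (Cmod_ge_0 p); intros H0; simpl.
apply Rle_lt_trans with (Cmod p * 1); [apply Rmult_le_compat_l|]; lra.
Qed.

Lemma mob_disk (p z : C) : Cmod p < 1 -> Cmod z < 1 -> Cmod (mob p z) < 1.
Proof.
intros Hp Hz; assert (N0 := mob_denom p z Hp (Rlt_le _ _ Hz)).
unfold mob; rewrite Cmod_div by exact N0.
assert (P0 := proj1 (Cmod_gt_0 _) N0).
apply Rlt_div_l; [exact P0|]; rewrite Rmult_1_l.
apply Rsqr_incrst_0; try apply Cmod_ge_0; rewrite !Rsqr_pow2.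
assert (H := mob_identity p z).
assert (0 < (1 - Cmod z ^ 2) * (1 - Cmod p ^ 2)).
{ apply Rmult_lt_0_compat; [generalize (Cmod_sqr_lt1 z Hz) | generalize (Cmod_sqr_lt1 p Hp)]; lra. }
lra.
Qed.

Lemma one_minus_sqr_neq0 (p : C) : Cmod p < 1 -> (1 - Cconj p * p)%C <> RtoC 0.
Proof. intros Hp; apply mob_denom; lra. Qed.

Lemma mob_inv (p z : C) : Cmod p < 1 -> (1 - Cconj p * z)%C <> RtoC 0 ->
  mob (- p) (mob p z) = z.
Proof.
intros Hp Hz; assert (Hpp := one_minus_sqr_neq0 p Hp).
unfold mob; rewrite Copp_conj; field; split; [exact Hz|].
intros E; apply Hpp; rewrite <- E; ring.
Qed.

Lemma mob_0 (p : C) : mob p p = RtoC 0.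
Proof. unfold mob, Cdiv; ring. Qed.

Lemma geo_mul_mob (r : R) (p : C) (F : C -> C) : Cmod p < r ->
  (exists a, geo r F a) -> exists a, geo r (fun z => mob p z * F z)%C a.
Proof.
intros Hp [a Ha].
assert (Hr : 0 < r) by (generalize (Cmod_ge_0 p); lra).
eexists; eapply geo_ext.
2:{ apply (geo_gdiv r (Cconj p)); [rewrite Cmod_conj; exact Hp|].
    apply geo_plus; [apply geo_shift, Ha; exact Hr | apply (geo_scal r (- p)%C), Ha]. }
intros z _; simpl; unfold mob, Cdiv; ring.
Qed.

Lemma geo_mob_pow (r : R) (p : C) (k : nat) : Cmod p < r ->
  exists a, geo r (fun z => mob p z ^ k)%C a.
Proof.
intros Hp; assert (Hr : 0 < r) by (generalize (Cmod_ge_0 p); lra).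
induction k as [|k IH]; [exists (delta 1); exact (geo_const r 1 Hr)|].
exact (geo_mul_mob r p _ Hp IH).
Qed.

Lemma gdiv_delta (q : C) (n : nat) : gdiv q (delta 1) n = (q ^ n)%C.
Proof. induction n as [|n IH]; simpl; [|rewrite IH]; ring. Qed.

(** These are the coefficients (n+1) q^n of 1/(1 - q z)^2; hence the successor in the index. *)
Lemma gdiv_pow (q : C) (n : nat) : gdiv q (fun k => q ^ k)%C n = dpow q (S n).
Proof. induction n as [|n IH]; [simpl; ring|]. simpl gdiv; rewrite IH; simpl; ring. Qed.

Lemma geo_kernel (r : R) (q : C) : Cmod q < r ->
  geo r (fun z => 1 / (1 - q * z))%C (fun n => q ^ n)%C.
Proof.
intros Hq; assert (Hr : 0 < r) by (generalize (Cmod_ge_0 q); lra).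
rewrite <- (functional_extensionality _ _ (gdiv_delta q)).
apply (geo_gdiv r q (fun _ => RtoC 1)), (geo_const r 1 Hr); exact Hq.
Qed.

Lemma geo_kernel_sqr (r : R) (q : C) : Cmod q < r ->
  geo r (fun z => 1 / (1 - q * z) / (1 - q * z))%C (fun n => dpow q (S n)).
Proof.
intros Hq; rewrite <- (functional_extensionality _ _ (gdiv_pow q)).
apply (geo_gdiv r q (fun z => 1 / (1 - q * z))%C), geo_kernel; exact Hq.
Qed.

Lemma geo_mob_kernel (r : R) (p : C) : Cmod p < r ->
  geo r (fun z => mob p z / (1 - Cconj p * z))%C
    (fun n => dpow (Cconj p) n - p * dpow (Cconj p) (S n))%C.
Proof.
intros Hp; assert (Hr : 0 < r) by (generalize (Cmod_ge_0 p); lra).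
assert (Hq : Cmod (Cconj p) < r) by (rewrite Cmod_conj; exact Hp).
assert (H := geo_kernel_sqr r (Cconj p) Hq).
assert (H' := geo_plus _ _ _ _ _ (geo_shift _ _ _ Hr H) (geo_scal r (- p)%C _ _ H)).
replace (fun n => dpow (Cconj p) n - p * dpow (Cconj p) (S n))%C with
  (fun n => shift (fun m => dpow (Cconj p) (S m)) n + - p * dpow (Cconj p) (S n))%C.
- apply geo_ext with (2 := H'); intros z _; unfold mob, Cdiv; ring.
- apply functional_extensionality; intros [|n]; simpl; ring.
Qed.

Lemma dpow_conj (p : C) (n : nat) : Cconj (dpow p n) = dpow (Cconj p) n.
Proof.
induction n as [|n IH]; simpl.
- apply injective_projections; simpl; ring.
- rewrite Cplus_conj, Cmult_conj, Cpow_conj, IH; reflexivity.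
Qed.

Lemma Cmod_minus_sqr (x y : C) :
  Cmod (x - y)%C ^ 2 = Cmod x ^ 2 + Cmod y ^ 2 - 2 * Re (x * Cconj y)%C.
Proof.
assert (N : forall u : C, Cmod u ^ 2 = Re u ^ 2 + Im u ^ 2).
{ intros u; unfold Cmod; rewrite pow2_sqrt; [reflexivity|].
  generalize (pow2_ge_0 (fst u)) (pow2_ge_0 (snd u)); lra. }
rewrite !N; destruct x as [x1 x2], y as [y1 y2]; unfold Re, Im; simpl; ring.
Qed.

(** * Rigidity in the Schwarz lemma *)

Lemma kernel_norm (q : C) (n : nat) : Cmod q < 1 ->
  rsum (fun k => Cmod (q ^ k)%C ^ 2) n <= / (1 - Cmod q ^ 2).
Proof.
intros Hq; rewrite (rsum_ext _ (pow (Cmod q ^ 2))).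
- apply rsum_geom; split; [apply pow2_ge_0 | apply Cmod_sqr_lt1, Hq].
- intros k _; rewrite Cmod_pow, <- !pow_mult, Nat.mul_comm; reflexivity.
Qed.

(* The Hardy norm of g/(1 - conj p z) is at most that of the kernel
   1/(1 - conj p z); letting rho tend to 1 in parseval_le. *)
Lemma kernel_multiplier_norm (nu : R) (p : C) (g : dirichlet nu) (n : nat) : Cmod p < 1 ->
  (forall z, Cmod (g z) <= 1) ->
  rsum (fun k => Cmod (gdiv (Cconj p) (taylor g) k) ^ 2) n <= / (1 - Cmod p ^ 2).
Proof.
intros Hp Hg.
assert (Hq : Cmod (Cconj p) < 1) by (rewrite Cmod_conj; exact Hp).
set (q := Cconj p) in *; set (B := / (1 - Cmod p ^ 2)).
set (b := gdiv q (taylor g)).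
assert (main : forall rho, 0 <= rho < 1 ->
  rsum (fun k => (Cmod (b k) * rho ^ k) ^ 2) n <= B).
{ intros rho Hrho; destruct (radius_gap rho Hrho) as [s [Hs Hrs]].
  apply (parseval_le s rho (fun z => extend g z / (1 - q * z))%C
    (fun z => 1 / (1 - q * z))%C b (fun k => q ^ k)%C B); try lra.
  - apply geo_gdiv; [lra | apply dirichlet_geo, Hs].
  - apply geo_kernel; lra.
  - intros z Hz; assert (Hz1 : Cmod z < 1) by lra.
    assert (N0 := mob_denom p z Hp (Rlt_le _ _ Hz1)); fold q in N0.
    rewrite !Cmod_div by exact N0; apply Rmult_le_compat_r.
    + apply Rlt_le, Rinv_0_lt_compat, Cmod_gt_0, N0.
    + change z with (disk_val (Disk z Hz1)); rewrite extend_disk, Cmod_1; apply Hg.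
  - intros m; apply Rle_trans with (rsum (fun k => Cmod (q ^ k)%C ^ 2) m).
    + apply rsum_le; intros k _; apply pow_incr; split.
      * apply Rmult_le_pos; [apply Cmod_ge_0 | apply pow_le; lra].
      * rewrite <- (Rmult_1_r (Cmod (q ^ k)%C)) at 2.
        apply Rmult_le_compat_l; [apply Cmod_ge_0|].
        rewrite <- (pow1 k); apply pow_incr; lra.
    + unfold B; rewrite <- (Cmod_conj p); apply kernel_norm, Hq. }
(* With n fixed the sum is finite, so rho may tend to 1 term by term, along 1 - 1/(m+1), which
   starts at 0. *)
assert (L : is_lim_seq (fun m => rsum (fun k => (Cmod (b k) * (1 - / INR (S m)) ^ k) ^ 2) n)
  (rsum (fun k => Cmod (b k) ^ 2) n)).
{ assert (L1 : is_lim_seq (fun m => 1 - / INR (S m)) 1).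
  { replace (Finite 1) with (Finite (1 - 0)) by (f_equal; ring).
    apply is_lim_seq_minus'; [apply is_lim_seq_const|].
    apply (is_lim_seq_incr_1 (fun m => / INR m)).
    replace (Finite 0) with (Rbar_inv p_infty) by reflexivity.
    apply is_lim_seq_inv; [apply is_lim_seq_INR | discriminate]. }
  assert (L2 : forall k, is_lim_seq (fun m => (1 - / INR (S m)) ^ k) 1).
  { induction k as [|k IH]; [apply is_lim_seq_const|].
    simpl; replace (Finite 1) with (Finite (1 * 1)) by (f_equal; ring).
    apply is_lim_seq_mult'; assumption. }
  clear main; induction n as [|i IH]; [apply is_lim_seq_const|]; cbn [rsum].
  apply is_lim_seq_plus'; [exact IH|].
  assert (L3 : is_lim_seq (fun m => Cmod (b i) * (1 - / INR (S m)) ^ i) (Cmod (b i))).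
  { replace (Finite (Cmod (b i))) with (Finite (Cmod (b i) * 1)) by (f_equal; ring).
    apply is_lim_seq_mult'; [apply is_lim_seq_const | apply L2]. }
  replace (Finite (Cmod (b i) ^ 2)) with (Finite (Cmod (b i) * Cmod (b i))) by (f_equal; ring).
  apply is_lim_seq_ext with (fun m => (Cmod (b i) * (1 - / INR (S m)) ^ i)
    * (Cmod (b i) * (1 - / INR (S m)) ^ i)).
  { intros m; rewrite <- Rsqr_pow2; reflexivity. }
  apply is_lim_seq_mult'; exact L3. }
apply (fun H => is_lim_seq_le _ _ _ _ H L (is_lim_seq_const B)); intros m; apply main.
assert (H1 : 1 <= INR (S m)) by (apply (le_INR 1); lia).
assert (H2 : 0 < / INR (S m)) by (apply Rinv_0_lt_compat; lra).
assert (H3 : / INR (S m) <= / 1) by (apply Rinv_le_contravar; lra).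
rewrite Rinv_1 in H3; lra.
Qed.

(** Both functions are analytic beyond the closed disk, so the comparison is made at radius 1
    itself, where |mob p z| = 1. *)
Lemma mob_kernel_norm (p : C) (n : nat) : Cmod p < 1 ->
  rsum (fun k => Cmod (dpow (Cconj p) k - p * dpow (Cconj p) (S k))%C ^ 2) n
    <= / (1 - Cmod p ^ 2).
Proof.
intros Hp; set (r := (1 + Cmod p) / 2).
assert (Hr : Cmod p < r < 1) by (unfold r; lra).
assert (H0 := Cmod_ge_0 p).
rewrite (rsum_ext _ (fun k => (Cmod (dpow (Cconj p) k - p * dpow (Cconj p) (S k))%C * 1 ^ k) ^ 2))
  by (intros; rewrite pow1, Rmult_1_r; reflexivity).
apply (parseval_le r 1 (fun z => mob p z / (1 - Cconj p * z))%C
  (fun z => 1 / (1 - Cconj p * z))%C _ (fun k => Cconj p ^ k)%C); try lra.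
- apply geo_mob_kernel; lra.
- apply geo_kernel; rewrite Cmod_conj; lra.
- intros z Hz.
  assert (N0 := mob_denom p z Hp (Req_le _ _ Hz)).
  rewrite !Cmod_div by exact N0; apply Rmult_le_compat_r.
  + apply Rlt_le, Rinv_0_lt_compat, Cmod_gt_0, N0.
  + unfold mob; rewrite Cmod_div, Cmod_1 by exact N0.
    assert (P0 := proj1 (Cmod_gt_0 _) N0).
    apply Rle_div_l; [exact P0|]; rewrite Rmult_1_l.
    apply Rsqr_incr_0; try apply Cmod_ge_0; rewrite !Rsqr_pow2.
    assert (H := mob_identity p z); rewrite Hz in H; lra.
- intros m; rewrite (rsum_ext _ (fun k => Cmod (Cconj p ^ k)%C ^ 2))
    by (intros; rewrite pow1, Rmult_1_r; reflexivity).
  rewrite <- (Cmod_conj p); apply kernel_norm; rewrite Cmod_conj; exact Hp.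
Qed.

(* Equality in Cauchy-Schwarz: g/(1 - conj p z) is paired with the extremal
   function mob p z/(1 - conj p z), both of squared norm 1/(1 - |p|^2), and the
   pairing is the derivative d of g at p. *)
Lemma schwarz_rigidity (nu : R) (p : disk) (g : dirichlet nu) (d : C) :
  (forall z, Cmod (g z) <= 1) -> g p = 0%C -> hasder g p d ->
  Cmod d * (1 - Cmod p ^ 2) = 1 ->
  exists mu, Cmod mu = 1 /\ forall z : disk, g z = (mu * mob p z)%C.
Proof.
intros Hg Hgp Hd Hd1.
assert (Hp := disk_lt1 p).
set (q := Cconj p); set (S2 := 1 - Cmod p ^ 2).
assert (HS : 0 < S2) by (unfold S2; generalize (Cmod_sqr_lt1 p Hp); lra).
set (b := gdiv q (taylor g)).
set (e := fun n => (dpow q n - p * dpow q (S n))%C).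
set (G := fun z => (extend g z / (1 - q * z))%C).
assert (Hq : Cmod q < 1) by (unfold q; rewrite Cmod_conj; exact Hp).
destruct (radius_gap (Cmod p)) as [s [Hs Hps]]; [split; [apply Cmod_ge_0 | exact Hp]|].
assert (gG : forall s, 1 < s -> geo s G b).
{ intros t Ht; apply geo_gdiv; [lra | apply dirichlet_geo, Ht]. }
assert (Gz : forall z : disk, G z = (g z / (1 - q * z))%C).
{ intros z; unfold G; rewrite extend_disk; reflexivity. }
assert (Nz : forall z : disk, (1 - q * z)%C <> RtoC 0).
{ intros z; apply mob_denom; [exact Hp | apply Rlt_le, disk_lt1]. }
destruct (geo_hasder s p ltac:(lra) Hps) as [K HK].
destruct (gG s Hs) as [[M HM] HGs].
destruct (HK (fun z => G z) G b M (fun _ => eq_refl) (gG s Hs) HM) as [D [HD1 [HD2 _]]].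
assert (Gp : G p = RtoC 0) by (rewrite Gz, Hgp; unfold Cdiv; ring).
(* Product rule for g = G (1 - q z); the second term drops out because G(p) = 0. *)
assert (HD : (D * (1 - q * p))%C = d).
{ apply (hasder_unique g p); [|exact Hd].
  replace (D * (1 - q * p))%C with (D * (1 - q * p) + G p * (0 + (- q) * 1))%C
    by (rewrite Gp; ring).
  apply hasder_ext with (fun z : disk => G z * (1 + (- q) * z))%C.
  - intros z; rewrite Gz; field; apply Nz.
  - replace (1 - q * p)%C with (1 + (- q) * p)%C by ring.
    apply (hasder_mult (fun z => G z) (fun z : disk => (1 + (- q) * z)%C) p _ _ HD2).
    apply hasder_plus; [apply hasder_const | apply hasder_scal, hasder_id]. }
(* The conjugate of e_k is (1 - q p) k p^(k-1) - q p^k, so the pairing equals (1 - q p) G'(p) - q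
   G(p), which is d. *)
assert (L : Clim (csum (fun k => b k * Cconj (e k))%C) d).
{ replace d with ((1 - q * p) * D + (- q) * 0)%C by (rewrite <- HD; ring).
  apply Clim_ext with (fun n => (1 - q * p) * csum (fun k => b k * dpow p k)%C n
    + (- q) * csum (fun k => b k * p ^ k)%C n)%C.
  - intros n; rewrite <- !csum_scal, <- csum_plus; apply csum_ext; intros k _.
    unfold e; rewrite Cminus_conj, Cmult_conj, !dpow_conj; unfold q; rewrite Cconj_conj.
    simpl; ring.
  - apply Clim_plus; apply Clim_scal; [exact HD1|]; rewrite <- Gp; apply HGs, Hps. }
(* The only possible factor: [mob p] has derivative 1/(1 - |p|^2) at p, so mu is the quotient of the
   two derivatives. *)
set (mu := (d * S2)%C).
assert (Hmu : Cmod mu = 1).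
{ unfold mu; rewrite Cmod_mult, Cmod_R, Rabs_pos_eq by lra; exact Hd1. }
assert (Hd2 : Re (d * Cconj mu)%C = / S2).
{ unfold mu; rewrite Cmult_conj; replace (Cconj S2) with (RtoC S2)
    by (apply injective_projections; simpl; ring).
  rewrite Cmult_assoc, <- Cmod2_conj, <- RtoC_mult, re_RtoC.
  apply Rmult_eq_reg_r with S2; [|lra]; rewrite Rinv_l by lra.
  rewrite Rmult_assoc; fold S2 in Hd1.
  replace (Cmod d ^ 2 * (S2 * S2)) with ((Cmod d * S2) ^ 2) by ring; rewrite Hd1; ring. }
(* Expanding the square, each norm contributes at most 1/S2, while the cross term tends to 2/S2. *)
assert (Z : forall n, rsum (fun k => Cmod (b k - mu * e k)%C ^ 2) n <= 0).
{ assert (B : forall n, rsum (fun k => Cmod (b k - mu * e k)%C ^ 2) n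
    <= 2 * / S2 - 2 * Re (Cconj mu * csum (fun k => b k * Cconj (e k))%C n)%C).
  { intros n; rewrite (rsum_ext _ (fun k => Cmod (b k) ^ 2 +
      (Cmod (e k) ^ 2 + (-2) * Re (Cconj mu * (b k * Cconj (e k)))%C))).
    2:{ intros k _; rewrite Cmod_minus_sqr, Cmod_mult, Hmu, Rmult_1_l, Cmult_conj.
        replace (b k * (Cconj mu * Cconj (e k)))%C with (Cconj mu * (b k * Cconj (e k)))%C by ring.
        ring. }
    rewrite !rsum_plus, (rsum_scal (-2) (fun k => Re (Cconj mu * (b k * Cconj (e k)))%C)).
    assert (ER : rsum (fun k => Re (Cconj mu * (b k * Cconj (e k)))%C) n
      = Re (Cconj mu * csum (fun k => b k * Cconj (e k))%C n)%C).
    { rewrite <- csum_scal; clear; induction n as [|n IH]; cbn [rsum csum]; [reflexivity|].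
      rewrite IH; reflexivity. }
    rewrite ER.
    generalize (kernel_multiplier_norm nu p g n Hp Hg) (mob_kernel_norm p n Hp).
    fold q; fold b; fold S2; unfold e; lra. }
  intros n.
  assert (L2 : is_lim_seq (fun n => Re (Cconj mu * csum (fun k => b k * Cconj (e k))%C n)%C) (/ S2)).
  { rewrite <- Hd2, Cmult_comm.
    set (u := csum (fun k => b k * Cconj (e k))%C) in *.
    apply is_lim_seq_ext with (fun n => Re (Cconj mu * (u n - d))%C + Re (Cconj mu * d)%C).
    { intros m; unfold Re; simpl; ring. }
    rewrite <- (Rplus_0_l (Re (Cconj mu * d)%C)) at 1.
    apply is_lim_seq_plus'; [|apply is_lim_seq_const].
    apply is_lim_seq_abs_0.
    apply is_lim_seq_le_le with (fun _ => 0) (fun m => Cmod (u m - d)%C);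
      [|apply is_lim_seq_const | exact L].
    intros m; split; [apply Rabs_pos|].
    apply Rle_trans with (Cmod (Cconj mu * (u m - d))%C).
    - apply Rle_trans with (2 := Rmax_Cmod _), Rmax_l.
    - rewrite Cmod_mult, Cmod_conj, Hmu; lra. }
  assert (L3 : is_lim_seq (fun n => 2 * / S2 -
    2 * Re (Cconj mu * csum (fun k => b k * Cconj (e k))%C n)%C) (2 * / S2 - 2 * / S2)).
  { apply is_lim_seq_minus'; [apply is_lim_seq_const|].
    apply is_lim_seq_mult'; [apply is_lim_seq_const | exact L2]. }
  replace (2 * / S2 - 2 * / S2) with 0 in L3 by ring.
  apply (is_lim_seq_le_loc (fun _ => rsum (fun k => Cmod (b k - mu * e k)%C ^ 2) n) _ _ _)
    with (2 := is_lim_seq_const _) (3 := L3).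
  exists n; intros m Hm; apply Rle_trans with (2 := B m).
  apply rsum_mono; [intros; apply pow2_ge_0 | exact Hm]. }
assert (be : forall k, b k = (mu * e k)%C).
{ intros k; apply (proj2 (Ceq_minus _ _)), Cmod_eq_0.
  assert (T := rsum_term (fun k => Cmod (b k - mu * e k)%C ^ 2) k (S k)
    (fun i => pow2_ge_0 _) ltac:(lia)); simpl in T.
  specialize (Z (S k)); simpl in Z.
  generalize (Cmod_ge_0 (b k - mu * e k)%C); intros H0.
  destruct H0 as [H0|H0]; [|symmetry; exact H0].
  generalize (Rmult_lt_0_compat _ _ H0 H0); lra. }
exists mu; split; [exact Hmu|]; intros z.
destruct (radius_gap (Cmod z)) as [t [Ht Hzt]]; [split; [apply Cmod_ge_0 | apply disk_lt1]|].
assert (H1 := proj2 (gG t Ht) z Hzt).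
assert (H2 := proj2 (geo_scal t mu _ _ (geo_mob_kernel t p ltac:(lra))) z Hzt).
rewrite (functional_extensionality _ _ be) in H1.
assert (H3 := Clim_unique _ _ _ H1 H2); rewrite Gz in H3; fold q in H3.
transitivity (g z / (1 - q * z) * (1 - q * z))%C; [field; apply Nz|].
rewrite H3; field; apply Nz.
Qed.

(** Rigidity is applied to mob p o phi. This function is [T A], where [A] represents [mob p], and
    being a value of [T] provides the Taylor series that rigidity works on. *)
Lemma composition_rotation (nu : R) (phi : disk -> disk) (T : dirichlet nu -> dirichlet nu)
  (p : disk) (k : C) :
  composition_operator phi T -> phi p = p -> hasder (fun z => phi z : C) p k -> Cmod k = 1 ->
  exists mu, Cmod mu = 1 /\ forall z : disk, mob p (phi z) = (mu * mob p z)%C.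
Proof.
intros HT Ep Hk Hk1.
assert (Hp := disk_lt1 p).
assert (H0 := Cmod_ge_0 p).
destruct (geo_mob_pow ((1 + Cmod p) / 2) p 1 ltac:(lra)) as [a Ha].
destruct (dirichlet_of_geo nu ((1 + Cmod p) / 2) _ _ ltac:(lra) Ha) as [A [HA _]].
assert (E : forall z, T A z = mob p (phi z)).
{ intros z; rewrite HT, HA; simpl; ring. }
destruct (dirichlet_hasder nu p) as [K [_ HK]].
destruct (HK (T A)) as [d [Hd _]].
assert (Hpp := one_minus_sqr_neq0 p Hp).
(* Differentiate phi = (mob p o phi) (1 - conj p phi) + p at p, where mob p o phi vanishes. *)
assert (Ed : (d * (1 - Cconj p * p))%C = k).
{ apply (hasder_unique (fun z => phi z : C) p); [|exact Hk].
  replace (d * (1 - Cconj p * p))%C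
    with (d * (1 + - Cconj p * phi p) + T A p * (0 + - Cconj p * k) + 0)%C
    by (rewrite E, Ep, mob_0; ring).
  apply hasder_ext with (fun z => T A z * (1 + - Cconj p * phi z) + p)%C.
  - intros z; rewrite E; unfold mob; field.
    apply mob_denom; [exact Hp | apply Rlt_le, disk_lt1].
  - apply hasder_plus; [|apply hasder_const].
    apply (hasder_mult (T A) (fun z => (1 + - Cconj p * phi z)%C)); [exact Hd|].
    apply hasder_plus; [apply hasder_const | apply hasder_scal, Hk]. }
destruct (schwarz_rigidity nu p (T A) d) as [mu [H1 H2]]; try assumption.
- intros z; rewrite E; apply Rlt_le, mob_disk; [exact Hp | apply disk_lt1].
- rewrite E, Ep, mob_0; reflexivity.
- transitivity (Cmod k); [|exact Hk1]; rewrite <- Ed, Cmod_mult; f_equal.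
  rewrite (Cmult_comm (Cconj p)), <- Cmod2_conj, <- RtoC_minus, Cmod_R, Rabs_pos_eq; [reflexivity|].
  generalize (Cmod_sqr_lt1 p Hp); lra.
- exists mu; split; [exact H1|]; intros z; rewrite <- E; apply H2.
Qed.

(** * Recurrence forces unimodular eigenvalues *)

Lemma open_dball (nu : R) (f : dirichlet nu) (e : R) :
  open (fun g : dirichlet nu => dnorm (minus g f) < e).
Proof.
intros x Hx; assert (H : 0 < e - dnorm (minus x f)) by lra.
exists (mkposreal _ H); intros y Hy.
change (dball nu x (e - dnorm (minus x f)) y) in Hy; unfold dball in Hy.
rewrite (minus_trans x y f).
apply Rle_lt_trans with (1 := dnorm_triangle nu _ _); lra.
Qed.

(** Near [f0] the functional is close to 1, so a point f returning at time n has both |L f| and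
    |k|^n |L f| close to 1. But for n >= 1, |k|^n lies beyond |k| on its side of 1, at a distance
    independent of n. [L] is a relation so that it covers the derivative at p as well as
    evaluation. *)
Lemma recurrent_eigenfunctional (nu : R) (T : dirichlet nu -> dirichlet nu)
  (L : dirichlet nu -> C -> Prop) (k : C) (K : R) (f0 : dirichlet nu) :
  (forall f, exists d, L f d) ->
  (forall f d, L f d -> L (T f) (k * d)%C) ->
  0 <= K ->
  (forall f g d e, L f d -> L g e -> Cmod (d - e)%C <= K * dnorm (minus f g)) ->
  L f0 1%C -> recurrent T -> Cmod k = 1.
Proof.
intros Hex HT HK Hc H0 Hrec.
set (t := Cmod k); assert (t0 : 0 <= t) by apply Cmod_ge_0.
destruct (Req_dec t 1) as [E|E]; [exact E|exfalso].
(* Half the threshold |t - 1|/(1 + t) at which the ranges t (1 +- del) and 1 +- del begin to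
   meet. *)
set (del := Rabs (t - 1) / (2 * (1 + t))).
assert (Hdel : 0 < del).
{ apply Rdiv_lt_0_compat; [apply Rabs_pos_lt|]; lra. }
assert (Edel : del * (1 + t) * 2 = Rabs (t - 1)) by (unfold del; field; lra).
destruct (Hrec (fun g => dnorm (minus g f0) < del / (K + 1))) as [n [Hn [f [Hf HTf]]]].
- apply open_dball.
- exists f0; rewrite minus_eq_zero; change (dnorm (dzero nu) < del / (K + 1)).
  rewrite dnorm_zero; apply Rdiv_lt_0_compat; lra.
- destruct (Hex f) as [d Hd].
  assert (Hit : forall m, L (Nat.iter m T f) (k ^ m * d)%C).
  { induction m as [|m IH]; simpl.
    - replace (1 * d)%C with d by ring; exact Hd.
    - rewrite <- Cmult_assoc; apply HT, IH. }
  assert (near : forall g e, L g e -> dnorm (minus g f0) < del / (K + 1) ->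
    1 - del <= Cmod e <= 1 + del).
  { intros g e Hg Hgn.
    assert (A : Cmod (e - 1)%C <= del).
    { apply Rle_trans with (1 := Hc _ _ _ _ Hg H0).
      apply Rle_trans with ((K + 1) * (del / (K + 1))).
      - apply Rmult_le_compat; [exact HK | apply dnorm_ge0 | |]; lra.
      - right; field; lra. }
    split.
    - assert (B := Cmod_triangle e (- (e - 1))%C); rewrite Cmod_opp in B.
      replace (e + - (e - 1))%C with (RtoC 1) in B by ring; rewrite Cmod_1 in B; lra.
    - assert (B := Cmod_triangle 1%C (e - 1)%C).
      replace (1 + (e - 1))%C with e in B by ring; rewrite Cmod_1 in B; lra. }
  destruct (near _ _ Hd Hf) as [A1 A2], (near _ _ (Hit n) HTf) as [B1 B2].
  rewrite Cmod_mult, Cmod_pow in B1, B2; fold t in B1, B2.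
  destruct n as [|n]; [lia|]; simpl in B1, B2.
  assert (P0 := pow_le t n t0).
  destruct (Rle_lt_dec t 1) as [Ht|Ht].
  + assert (P1 : t ^ n <= 1) by (rewrite <- (pow1 n); apply pow_incr; lra).
    rewrite Rabs_left in Edel by lra.
    assert (t * t ^ n <= t * 1) by (apply Rmult_le_compat_l; lra).
    assert (t * t ^ n * Cmod d <= t * 1 * (1 + del)).
    { apply Rmult_le_compat; try lra; [apply Rmult_le_pos; lra | apply Cmod_ge_0]. }
    lra.
  + assert (P1 : 1 <= t ^ n) by (apply pow_R1_Rle; lra).
    rewrite Rabs_pos_eq in Edel by lra.
    assert (t * 1 <= t * t ^ n) by (apply Rmult_le_compat_l; lra).
    assert (t * 1 * (1 - del) <= t * t ^ n * Cmod d).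
    { apply Rle_trans with (t * 1 * Cmod d).
      - apply Rmult_le_compat_l; lra.
      - apply Rmult_le_compat_r; [apply Cmod_ge_0 | lra]. }
    lra.
Qed.

Lemma dirichlet_one (nu : R) : exists f : dirichlet nu, forall z, f z = 1%C.
Proof.
destruct (dirichlet_of_geo nu (/ 2) _ _ ltac:(lra) (geo_const (/ 2) 1 ltac:(lra))) as [f [H _]].
exists f; exact H.
Qed.

Lemma dirichlet_id (nu : R) : exists f : dirichlet nu, forall z, f z = z.
Proof.
destruct (dirichlet_of_geo nu (/ 2) _ _ ltac:(lra)
  (geo_shift (/ 2) _ _ ltac:(lra) (geo_const (/ 2) 1 ltac:(lra)))) as [f [H _]].
exists f; intros z; rewrite H; ring.
Qed.

(** phi is the image under [T] of the coordinate function, so it inherits the differentiability of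
    elements of the space. *)
Lemma composition_symbol_hasder (nu : R) (phi : disk -> disk)
  (T : dirichlet nu -> dirichlet nu) (p : disk) :
  composition_operator phi T -> exists k, hasder (fun z => phi z : C) p k.
Proof.
intros HT; destruct (dirichlet_id nu) as [f Hf], (dirichlet_hasder nu p) as [K [_ HK]].
destruct (HK (T f)) as [k [Hk _]]; exists k.
apply hasder_ext with (2 := Hk); intros z; rewrite HT; apply Hf.
Qed.

Lemma recurrent_rotation (nu : R) (lambda : C) (phi : disk -> disk)
  (T : dirichlet nu -> dirichlet nu) (p : disk) :
  composition_operator phi T -> phi p = p ->
  recurrent (fun f : dirichlet nu => scal lambda (T f)) ->
  Cmod lambda = 1 /\
  exists mu, Cmod mu = 1 /\ forall z : disk, mob p (phi z) = (mu * mob p z)%C.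
Proof.
intros HT Ep Hrec.
assert (minusE : forall (f g : dirichlet nu) z, (minus f g : dirichlet nu) z = (f z + (-1) * g z)%C).
{ intros f g z; change ((minus f g : dirichlet nu) z) with (f z + - g z)%C; ring. }
assert (Hl : Cmod lambda = 1).
{ destruct (point_eval_bound nu p) as [K [HK0 HK]], (dirichlet_one nu) as [f0 Hf0].
  apply (recurrent_eigenfunctional nu _ (fun f d => f p = d) lambda K f0) with (6 := Hrec).
  - intros f; eexists; reflexivity.
  - intros f d <-; change (lambda * T f p = lambda * f p)%C; rewrite HT, Ep; reflexivity.
  - exact HK0.
  - intros f g d e <- <-; replace (f p - g p)%C with ((minus f g : dirichlet nu) p)
      by (rewrite minusE; ring).
    apply HK.
  - apply Hf0. }
split; [exact Hl|].
destruct (composition_symbol_hasder nu phi T p HT) as [k Hk].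
apply (composition_rotation nu phi T p k HT Ep Hk).
cut (Cmod (lambda * k)%C = 1); [rewrite Cmod_mult, Hl, Rmult_1_l; exact (fun E => E)|].
destruct (dirichlet_hasder nu p) as [K [HK0 HK]], (dirichlet_id nu) as [f0 Hf0].
apply (recurrent_eigenfunctional nu _ (fun f d => hasder f p d) (lambda * k)%C K f0)
  with (6 := Hrec).
- intros f; destruct (HK f) as [d [Hd _]]; exists d; exact Hd.
- intros f d Hd; replace (lambda * k * d)%C with (lambda * (d * k))%C by ring.
  apply hasder_ext with (fun z => lambda * T f z)%C; [reflexivity|].
  apply hasder_scal, hasder_ext with (fun z => f (phi z)).
  + intros z; rewrite HT; reflexivity.
  + apply hasder_comp; assumption.
- exact HK0.
- intros f g d e Hd He; destruct (HK (minus f g)) as [u [Hu Hub]].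
  replace (d - e)%C with u; [exact Hub|].
  apply (hasder_unique (minus f g : dirichlet nu) p _ _ Hu).
  replace (d - e)%C with (d + (-1) * e)%C by ring.
  apply hasder_ext with (fun z => f z + (-1) * g z)%C; [intros z; rewrite minusE; reflexivity|].
  apply hasder_plus; [exact Hd | apply hasder_scal, He].
- apply hasder_ext with (fun z => z : C); [intros z; rewrite Hf0; reflexivity | apply hasder_id].
Qed.

(** * Rotations about a point of the disk are elliptic automorphisms *)

Lemma Cmult_integral (x y : C) : (x * y)%C = RtoC 0 -> x = RtoC 0 \/ y = RtoC 0.
Proof.
intros H; destruct (Ceq_dec x 0%C) as [E|E]; [left; exact E|].
destruct (Ceq_dec y 0%C) as [E'|E']; [right; exact E'|].
destruct (Cmult_neq_0 _ _ E E' H).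
Qed.

Lemma lft_Some (a b c d z : C) : (c * z + d)%C <> RtoC 0 ->
  lft a b c d (Some z) = Some ((a * z + b) / (c * z + d))%C.
Proof. intros H; simpl; destruct (Ceq_dec _ _) as [E|E]; [contradiction | reflexivity]. Qed.

Lemma lft_pole (a b c d z : C) : (c * z + d)%C = RtoC 0 -> lft a b c d (Some z) = None.
Proof. intros H; simpl; destruct (Ceq_dec _ _) as [E|E]; [reflexivity | contradiction]. Qed.

Lemma lft_None (a b c d : C) : c <> RtoC 0 -> lft a b c d None = Some (a / c)%C.
Proof. intros H; simpl; destruct (Ceq_dec _ _) as [E|E]; [contradiction | reflexivity]. Qed.

Lemma lft_None_0 (a b c d : C) : c = RtoC 0 -> lft a b c d None = None.
Proof. intros H; simpl; destruct (Ceq_dec _ _) as [E|E]; [reflexivity | contradiction]. Qed.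

(** Composition is the product of matrices. The cases follow the poles; the nonzero determinant
    prevents numerator and denominator of the inner map from vanishing together. *)
Lemma lft_comp (a b c d a' b' c' d' : C) (P : Chat) : (a * d - b * c)%C <> RtoC 0 ->
  lft a' b' c' d' (lft a b c d P) =
  lft (a' * a + b' * c) (a' * b + b' * d) (c' * a + d' * c) (c' * b + d' * d) P.
Proof.
intros Hdet; destruct P as [z|].
- destruct (Ceq_dec (c * z + d)%C 0%C) as [E|E].
  + rewrite (lft_pole _ _ _ _ _ E).
    assert (N : (a * z + b)%C <> RtoC 0).
    { intros E'; apply Hdet.
      destruct (Ceq_dec c 0%C) as [Ec|Ec].
      - rewrite Ec in E |- *.
        assert (Ed : d = RtoC 0) by (rewrite <- E; ring); rewrite Ed; ring.
      - assert (Ez : z = (- d / c)%C).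
        { replace z with (((c * z + d) - d) / c)%C by (field; exact Ec).
          rewrite E; field; exact Ec. }
        replace (a * d - b * c)%C with (- c * (a * z + b))%C by (rewrite Ez; field; exact Ec).
        rewrite E'; ring. }
    assert (Ed : ((c' * a + d' * c) * z + (c' * b + d' * d))%C = (c' * (a * z + b))%C).
    { replace (c' * (a * z + b))%C with (c' * (a * z + b) + d' * (c * z + d))%C
        by (rewrite E; ring); ring. }
    assert (En : ((a' * a + b' * c) * z + (a' * b + b' * d))%C = (a' * (a * z + b))%C).
    { replace (a' * (a * z + b))%C with (a' * (a * z + b) + b' * (c * z + d))%C
        by (rewrite E; ring); ring. }
    destruct (Ceq_dec c' 0%C) as [Ec|Ec].
    * rewrite lft_None_0 by exact Ec; rewrite lft_pole; [reflexivity|].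
      rewrite Ed, Ec; ring.
    * rewrite lft_None by exact Ec; rewrite lft_Some; rewrite Ed.
      -- rewrite En; f_equal; field; split; assumption.
      -- apply Cmult_neq_0; assumption.
  + rewrite (lft_Some _ _ _ _ _ E).
    assert (Ed : ((c' * a + d' * c) * z + (c' * b + d' * d))%C =
      ((c * z + d) * (c' * ((a * z + b) / (c * z + d)) + d'))%C) by (field; exact E).
    destruct (Ceq_dec (c' * ((a * z + b) / (c * z + d)) + d')%C 0%C) as [E'|E'].
    * rewrite !lft_pole; [reflexivity | rewrite Ed, E'; ring | exact E'].
    * assert (E2 : ((c' * a + d' * c) * z + (c' * b + d' * d))%C <> RtoC 0).
      { rewrite Ed; apply Cmult_neq_0; assumption. }
      rewrite !lft_Some by assumption; f_equal; rewrite Ed; field; split;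
        first [exact E | intros E3; apply E2; rewrite <- E3; ring].
- destruct (Ceq_dec c 0%C) as [E|E].
  + assert (Ha : a <> RtoC 0) by (intros Ea; apply Hdet; rewrite Ea, E; ring).
    rewrite (lft_None_0 _ _ _ _ E).
    destruct (Ceq_dec c' 0%C) as [Ec|Ec].
    * rewrite !lft_None_0; [reflexivity | rewrite E, Ec; ring | exact Ec].
    * rewrite lft_None by exact Ec; rewrite lft_None.
      -- rewrite E; f_equal; field; split; assumption.
      -- rewrite E; replace (c' * a + d' * 0)%C with (c' * a)%C by ring.
         apply Cmult_neq_0; assumption.
  + rewrite (lft_None _ _ _ _ E).
    assert (Ed : (c' * a + d' * c)%C = (c * (c' * (a / c) + d'))%C) by (field; exact E).
    destruct (Ceq_dec (c' * (a / c) + d')%C 0%C) as [E'|E'].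
    * rewrite lft_pole by exact E'; rewrite lft_None_0; [reflexivity | rewrite Ed, E'; ring].
    * assert (E2 : (c' * a + d' * c)%C <> RtoC 0) by (rewrite Ed; apply Cmult_neq_0; assumption).
      rewrite lft_Some, lft_None by assumption; f_equal; rewrite Ed; field; split;
        first [exact E | intros E3; apply E2; rewrite <- E3; ring].
Qed.

Lemma lft_scalar (c : C) (P : Chat) : c <> RtoC 0 -> lft c 0 0 c P = P.
Proof.
intros Hc; destruct P as [z|].
- rewrite lft_Some; [f_equal; field; exact Hc|].
  replace (0 * z + c)%C with c by ring; exact Hc.
- apply lft_None_0; reflexivity.
Qed.

Lemma lft_ex_derive (a b c d z0 : C) : (c * z0 + d)%C <> RtoC 0 ->
  @ex_derive C_AbsRing C_NormedModule (fun z => (a * z + b) / (c * z + d))%C z0.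
Proof.
intros N0; set (m := Cmod (c * z0 + d)%C).
assert (Hm : 0 < m) by (apply Cmod_gt_0, N0).
set (D := (a * d - b * c)%C).
exists (D / (c * z0 + d) ^ 2)%C; split; [apply is_linear_scal_l|].
intros x Hx.
assert (Ex : x = z0) by (symmetry; exact (is_filter_lim_locally_unique _ _ Hx)); subst x; clear Hx.
intros [e He]; simpl.
(* The remainder is exactly -D c (z - z0)^2 / ((c z + d) (c z0 + d)^2). The first bound in [del]
   keeps |c z + d| >= m/2, which gives this K; the second makes K |z - z0| at most e. *)
set (K := Cmod D * Cmod c * / (m ^ 3 / 2)).
assert (Hc0 := Cmod_ge_0 c).
assert (HK : 0 <= K).
{ unfold K; apply Rmult_le_pos; [apply Rmult_le_pos; apply Cmod_ge_0|].
  apply Rlt_le, Rinv_0_lt_compat; generalize (pow_lt m 3 Hm); lra. }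
set (del := Rmin (m / (2 * (Cmod c + 1))) (e / (K + 1))).
assert (Hdel : 0 < del) by (apply Rmin_pos; apply Rdiv_lt_0_compat; lra).
exists (mkposreal del Hdel); intros z Hz.
change (Cmod (z - z0)%C < del) in Hz.
change (Cmod ((a * z + b) / (c * z + d) - (a * z0 + b) / (c * z0 + d)
  - (z - z0) * (D / (c * z0 + d) ^ 2))%C <= e * Cmod (z - z0)%C).
assert (Z1 := Rlt_le_trans _ _ _ Hz (Rmin_l _ _)).
assert (Z2 := Rlt_le_trans _ _ _ Hz (Rmin_r _ _)).
assert (Z0 := Cmod_ge_0 (z - z0)%C).
apply Rlt_div_r in Z1; [|lra]; apply Rlt_div_r in Z2; [|lra].
assert (Hlow : m / 2 <= Cmod (c * z + d)%C).
{ assert (T := Cmod_triangle (c * z + d)%C (- (c * (z - z0)))%C).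
  rewrite Cmod_opp, Cmod_mult in T.
  replace (c * z + d + - (c * (z - z0)))%C with (c * z0 + d)%C in T by ring; fold m in T; lra. }
assert (N1 : (c * z + d)%C <> RtoC 0) by (apply Cmod_gt_0; lra).
replace ((a * z + b) / (c * z + d) - (a * z0 + b) / (c * z0 + d)
  - (z - z0) * (D / (c * z0 + d) ^ 2))%C
  with (- (D * c / ((c * z + d) * (c * z0 + d) ^ 2)) * (z - z0) * (z - z0))%C
  by (unfold D; field; split; assumption).
rewrite !Cmod_mult; apply Rmult_le_compat_r; [exact Z0|].
apply Rle_trans with (K * Cmod (z - z0)%C); [|lra].
apply Rmult_le_compat_r; [exact Z0|].
rewrite Cmod_opp, Cmod_div, !Cmod_mult, Cmod_pow
  by (apply Cmult_neq_0; [exact N1 | apply Cpow_nz, N0]).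
fold m; unfold K, Rdiv; apply Rmult_le_compat_l; [apply Rmult_le_pos; apply Cmod_ge_0|].
apply Rinv_le_contravar; [generalize (pow_lt m 3 Hm); lra|].
apply Rle_trans with (m / 2 * m ^ 2); [right; field|].
apply Rmult_le_compat_r; [apply pow2_ge_0 | exact Hlow].
Qed.

Lemma rotation_elliptic_automorphism (phi : disk -> disk) (p : disk) (mu : C) :
  holomorphic (fun z : disk => phi z : C) -> (exists z, phi z <> z) -> Cmod mu = 1 ->
  (forall z : disk, mob p (phi z) = (mu * mob p z)%C) -> elliptic_automorphism phi.
Proof.
intros Hol [z1 Hz1] Hmu Hrot.
assert (Hp := disk_lt1 p).
assert (Hop : Cmod (- p)%C < 1) by (rewrite Cmod_opp; exact Hp).
set (q := Cconj p).
assert (Hpp := one_minus_sqr_neq0 p Hp); fold q in Hpp.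
assert (Nz : forall z, Cmod z < 1 -> (1 - q * z)%C <> RtoC 0).
{ intros z Hz; apply mob_denom; lra. }
assert (Nw : forall w, Cmod w < 1 -> (1 + q * w)%C <> RtoC 0).
{ intros w Hw; replace (1 + q * w)%C with (1 - Cconj (- p) * w)%C
    by (rewrite Copp_conj; fold q; ring).
  apply mob_denom; lra. }
assert (inv1 : forall z : disk, mob (- p) (mob p z) = z).
{ intros z; apply mob_inv; [exact Hp | apply Nz, disk_lt1]. }
assert (inv2 : forall w, Cmod w < 1 -> mob p (mob (- p) w) = w).
{ intros w Hw; replace (mob p (mob (- p) w)) with (mob (- - p) (mob (- p) w)) by (f_equal; ring).
  apply mob_inv; [exact Hop | apply mob_denom; lra]. }
assert (Hmd : forall z : disk, Cmod (mob p z) < 1).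
{ intros z; apply mob_disk; [exact Hp | apply disk_lt1]. }
set (mu' := Cconj mu).
assert (Hmm : (mu' * mu)%C = RtoC 1) by (unfold mu'; rewrite Cmult_comm; apply unit_conj, Hmu).
assert (Hw : forall z : disk, Cmod (mu' * mob p z)%C < 1).
{ intros z; unfold mu'; rewrite Cmod_mult, Cmod_conj, Hmu, Rmult_1_l; apply Hmd. }
assert (Hpsi : forall z : disk, Cmod (mob (- p) (mu' * mob p z))%C < 1).
{ intros z; apply mob_disk; [exact Hop | apply Hw]. }
split.
- split; [exact Hol|].
  exists (fun z => Disk _ (Hpsi z)); split; [|split].
  (* Entries of the matrix product for mob (-p), multiplication by conj mu, and [mob p]: the inverse
     rotation as a single fraction. *)
  + exists (fun z => ((mu' - p * q) * z + (p - mu' * p)) / ((q * mu' - q) * z + (1 - q * mu' * p)))%C.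
    assert (N : forall z : disk, ((q * mu' - q) * z + (1 - q * mu' * p))%C =
      ((1 - q * z) * (1 + q * (mu' * mob p z)))%C).
    { intros z; unfold mob; fold q; field; apply Nz, disk_lt1. }
    assert (N' : forall z : disk, ((q * mu' - q) * z + (1 - q * mu' * p))%C <> RtoC 0).
    { intros z; rewrite N; apply Cmult_neq_0; [apply Nz, disk_lt1 | apply Nw, Hw]. }
    split.
    * intros z; simpl; rewrite N.
      assert (A := Nz z (disk_lt1 z)); assert (B := Nw _ (Hw z)).
      transitivity ((mu' * (z - p) + p * (1 - q * z)) / (1 - q * z)
        / (1 + q * (mu' * mob p z)))%C.
      -- field; split; assumption.
      -- unfold mob at 2; rewrite Copp_conj; fold q.
         replace (1 - - q * (mu' * mob p z))%C with (1 + q * (mu' * mob p z))%C by ring.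
         unfold Cdiv at 1 3; f_equal; unfold mob; fold q; field; exact A.
    * intros z; apply lft_ex_derive, N'.
  + intros z; apply disk_eq; simpl.
    rewrite Hrot, Cmult_assoc, Hmm, Cmult_1_l; apply inv1.
  + intros z; apply disk_eq; rewrite <- inv1, Hrot; simpl.
    rewrite inv2 by apply Hw.
    rewrite Cmult_assoc, (Cmult_comm mu), Hmm, Cmult_1_l; apply inv1.
(* [S] extends [mob p] to the extended plane and [S'] is its inverse: the product of their matrices
   is the scalar 1 - |p|^2. *)
- set (S := lft 1 (- p) (- q) 1); set (S' := lft 1 p q 1).
  assert (dS : (1 * 1 - (- p) * (- q))%C <> RtoC 0).
  { intros E; apply Hpp; rewrite <- E; ring. }
  assert (dS' : (1 * 1 - p * q)%C <> RtoC 0).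
  { intros E; apply Hpp; rewrite <- E; ring. }
  assert (mu0 : mu <> RtoC 0) by (apply Cmod_gt_0; lra).
  assert (SS' : forall P, S (S' P) = P).
  { intros P; unfold S, S'; rewrite lft_comp by exact dS'.
    rewrite <- (lft_scalar (1 - q * p) P Hpp) at 2; f_equal; ring. }
  set (M := fun P => S' (dilation mu (S P))).
  assert (D0 : dilation mu (Some (RtoC 0)) = Some (RtoC 0)).
  { unfold dilation; rewrite lft_Some; [f_equal; field|].
    intros E; apply C1_nz; rewrite <- E; ring. }
  assert (DN : dilation mu None = None) by (apply lft_None_0; reflexivity).
  assert (MS : forall z : disk, M (Some (z : C)) = Some (phi z : C)).
  { intros z; unfold M, S.
    assert (A := Nz z (disk_lt1 z)).
    rewrite lft_Some by (intros E; apply A; rewrite <- E; ring).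
    replace ((1 * z + - p) / (- q * z + 1))%C with (mob p z).
    2:{ unfold mob; fold q; f_equal; ring. }
    unfold dilation; rewrite lft_Some
      by (replace (0 * mob p z + 1)%C with (RtoC 1) by ring; apply C1_nz).
    replace ((mu * mob p z + 0) / (0 * mob p z + 1))%C with (mob p (phi z)).
    2:{ rewrite Hrot; field. }
    assert (B := Nw _ (Hmd (phi z))).
    unfold S'; rewrite lft_Some by (intros E; apply B; rewrite <- E; ring).
    f_equal; rewrite <- (inv1 (phi z)) at 3; unfold mob at 3; rewrite Copp_conj; fold q.
    f_equal; ring. }
  exists M; split; [|exact MS]; split; [|split; [|split]].
  + eexists _, _, _, _; split.
    2:{ intros P; unfold M, S, S', dilation; rewrite lft_comp.
        - rewrite lft_comp by exact dS; reflexivity.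
        - intros E; apply mu0; rewrite <- E; ring. }
    intros E; apply (Cmult_neq_0 _ _ mu0 (Cmult_neq_0 _ _ dS dS')); rewrite <- E; ring.
  + exists (Some (z1 : C)); rewrite MS; intros E; apply Hz1, disk_eq; congruence.
  (* The fixed points 0 and infinity of the dilation pulled back: p and its reflection 1/conj p in
     the unit circle. *)
  + exists (S' (Some (RtoC 0))), (S' None); split; [|split].
    * intros E; apply (f_equal S) in E; rewrite !SS' in E; discriminate.
    * unfold M; rewrite SS', D0; reflexivity.
    * unfold M; rewrite SS', DN; reflexivity.
  + exists S, mu; split; [|split; [exact Hmu|]].
    * exists 1%C, (- p)%C, (- q)%C, 1%C; split; [exact dS | reflexivity].
    * intros P; unfold M; apply SS'.
Qed.

(** * Density of the polynomials in a disk automorphism *)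

Lemma minusE (nu : R) (f g : dirichlet nu) (z : disk) :
  (minus f g : dirichlet nu) z = (f z - g z)%C.
Proof. reflexivity. Qed.

Lemma geo_csum (r : R) (c : nat -> C) (F : nat -> C -> C) (n : nat) : 0 < r ->
  (forall k, exists a, geo r (F k) a) ->
  exists a, geo r (fun z => csum (fun k => c k * F k z)%C n) a.
Proof.
intros Hr H; induction n as [|n [a IH]].
- exists (delta 0); exact (geo_const r 0 Hr).
- destruct (H n) as [b Hb]; eexists.
  apply (geo_plus r _ _ _ _ IH (geo_scal r (c n) _ _ Hb)).
Qed.

Definition trunc (a : nat -> C) (n k : nat) : C := if Nat.ltb k n then a k else 0%C.

(** Horner's scheme: the constant term plus z times the polynomial with shifted coefficients. *)
Lemma geo_trunc (r : R) (a : nat -> C) (n : nat) : 0 < r ->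
  geo r (fun z => csum (fun k => a k * z ^ k)%C n) (trunc a n).
Proof.
intros Hr; revert a; induction n as [|n IH]; intros a.
- replace (trunc a 0) with (delta 0).
  + exact (geo_const r 0 Hr).
  + apply functional_extensionality; intros [|k]; reflexivity.
- assert (H := geo_plus _ _ _ _ _ (geo_const r (a O) Hr) (geo_shift _ _ _ Hr (IH (fun k => a (S k))))).
  replace (trunc a (S n)) with (fun k => delta (a O) k + shift (trunc (fun k => a (S k)) n) k)%C.
  + apply geo_ext with (2 := H); intros z _; clear.
    induction n as [|n IH]; [simpl; ring|].
    change (csum (fun k => a k * z ^ k)%C (S (S n))) with
      (csum (fun k => a k * z ^ k)%C (S n) + a (S n) * z ^ (S n))%C.
    rewrite <- IH; simpl; ring.
  + apply functional_extensionality; intros [|k]; unfold trunc; simpl; [ring|].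
    change (Nat.ltb (S k) (S n)) with (Nat.ltb k n); ring.
Qed.

Lemma polynomials_dense (nu : R) (f : dirichlet nu) (e : R) : 0 < e ->
  exists (t : nat -> C) (m : nat) (g : dirichlet nu),
    (forall z : disk, g z = csum (fun k => t k * z ^ k)%C m) /\ dnorm (minus f g) < e.
Proof.
intros He.
set (u := wsq nu (taylor f)).
assert (u0 : forall n, 0 <= u n) by (apply wsq_ge0).
assert (L := Series_correct _ (taylor_sq f)); fold u in L.
assert (L' : is_lim_seq (sum_n u) (Series u)) by exact L.
assert (He4 : 0 < (e / 2) ^ 2) by (apply pow_lt; lra).
destruct (proj2 (is_lim_seq_spec _ _) L' (mkposreal _ He4)) as [n Hn].
specialize (Hn n (Nat.le_refl n)); simpl in Hn; rewrite sum_n_rsum in Hn.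
apply Rabs_def2 in Hn; destruct Hn as [_ Hn].
exists (taylor f), (S n).
destruct (dirichlet_of_geo nu (/ 2) _ _ ltac:(lra) (geo_trunc (/ 2) (taylor f) (S n) ltac:(lra)))
  as [g [Hg1 Hg2]].
exists g; split; [exact Hg1|].
apply Rle_lt_trans with (e / 2); [|lra].
apply dnorm_le_rsum; [lra|].
set (v := wsq nu (taylor (minus f g))).
assert (Hv : forall k, v k = if Nat.ltb k (S n) then 0 else u k).
{ intros k; unfold v, u, wsq.
  change (taylor (minus f g) k) with (taylor f k + - taylor g k)%C; rewrite Hg2; unfold trunc.
  destruct (Nat.ltb k (S n)).
  - replace (taylor f k + - taylor f k)%C with (RtoC 0) by ring; rewrite Cmod_0; ring.
  - replace (taylor f k + - 0)%C with (taylor f k) by ring; reflexivity. }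
assert (v0 : forall k, 0 <= v k) by (apply wsq_ge0).
assert (E : forall m, rsum v (S n + m) = rsum u (S n + m) - rsum u (S n)).
{ induction m as [|m IH].
  - rewrite Nat.add_0_r; rewrite (rsum_ext v (fun _ => 0)).
    + rewrite rsum_const; ring.
    + intros k Hk; rewrite Hv; apply Nat.ltb_lt in Hk; rewrite Hk; reflexivity.
  - rewrite Nat.add_succ_r.
    change (rsum v (S n + m) + v (S n + m)%nat
      = rsum u (S n + m) + u (S n + m)%nat - rsum u (S n)).
    rewrite IH, Hv.
    replace (Nat.ltb (S n + m) (S n)) with false by (symmetry; apply Nat.ltb_ge; lia); ring. }
intros m; apply Rle_trans with (rsum v (S n + m)); [apply rsum_mono; [exact v0 | lia]|].
rewrite E; generalize (rsum_le_Series u (S n + m) u0 (taylor_sq f)); simpl in *; lra.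
Qed.

(** Project z radially to u on the unit circle, where |u - p| = |1 - conj p u| = m >= 1 - |p|.
    Returning to z changes numerator and denominator by at most t (1 - |p|) <= t m each. *)
Lemma mob_near_circle (p : C) (t : R) (z : C) : Cmod p < 1 -> 0 < t < 1 ->
  Cmod z = 1 + t * (1 - Cmod p) -> Cmod p * Cmod z < 1 ->
  Cmod (mob p z) <= (1 + t) / (1 - t).
Proof.
intros Hp Ht Hz Hpz.
assert (H0 := Cmod_ge_0 p).
assert (N0 : (1 - Cconj p * z)%C <> RtoC 0) by (apply one_minus_neq0; rewrite Cmod_conj; exact Hpz).
assert (P0 := proj1 (Cmod_gt_0 _) N0).
unfold mob; rewrite Cmod_div by exact N0.
apply Rle_div_l; [exact P0|].
apply Rmult_le_reg_l with (1 - t); [lra|].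
replace ((1 - t) * ((1 + t) / (1 - t) * Cmod (1 - Cconj p * z)%C))
  with ((1 + t) * Cmod (1 - Cconj p * z)%C) by (field; lra).
set (rho := Cmod z) in *.
assert (Hs : 0 <= t * (1 - Cmod p)) by (apply Rmult_le_pos; lra).
set (u := (z / rho)%C).
assert (rho0 : RtoC rho <> RtoC 0) by (intros E; apply RtoC_inj in E; lra).
assert (Hu : Cmod u = 1).
{ unfold u; rewrite Cmod_div, Cmod_R, Rabs_pos_eq by (lra || exact rho0).
  fold rho; field; lra. }
assert (Ez : z = (u + (t * (1 - Cmod p))%R * u)%C).
{ unfold u; replace (t * (1 - Cmod p)) with (rho - 1) by lra.
  rewrite RtoC_minus; field; exact rho0. }
assert (Em : Cmod (u - p)%C = Cmod (1 - Cconj p * u)%C).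
{ assert (I := mob_identity p u); rewrite Hu in I.
  assert (I' : Cmod (u - p)%C ^ 2 = Cmod (1 - Cconj p * u)%C ^ 2) by lra.
  apply Rsqr_inj; try apply Cmod_ge_0; rewrite !Rsqr_pow2; exact I'. }
set (m := Cmod (1 - Cconj p * u)%C) in *.
assert (Hm : 1 - Cmod p <= m).
{ assert (T := Cmod_triangle (1 - Cconj p * u)%C (Cconj p * u)%C).
  replace (1 - Cconj p * u + Cconj p * u)%C with (RtoC 1) in T by ring.
  rewrite Cmod_1, Cmod_mult, Cmod_conj, Hu in T; fold m in T; lra. }
assert (A1 : Cmod (z - p)%C <= m + t * (1 - Cmod p)).
{ rewrite Ez; replace (u + (t * (1 - Cmod p))%R * u - p)%C
    with ((u - p) + (t * (1 - Cmod p))%R * u)%C by ring.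
  apply Rle_trans with (1 := Cmod_triangle _ _).
  rewrite Em, Cmod_mult, Hu, Cmod_R, Rabs_pos_eq by exact Hs; lra. }
assert (A2 : m - t * (1 - Cmod p) <= Cmod (1 - Cconj p * z)%C).
{ assert (T := Cmod_triangle (1 - Cconj p * z)%C (Cconj p * ((t * (1 - Cmod p))%R * u))%C).
  replace (1 - Cconj p * z + Cconj p * ((t * (1 - Cmod p))%R * u))%C
    with (1 - Cconj p * u)%C in T by (rewrite Ez at 1; ring).
  rewrite !Cmod_mult, Cmod_conj, Hu, Cmod_R, (Rabs_pos_eq _ Hs) in T; fold m in T.
  assert (Cmod p * (t * (1 - Cmod p) * 1) <= 1 * (t * (1 - Cmod p)))
    by (rewrite Rmult_1_r; apply Rmult_le_compat_r; lra).
  lra. }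
assert (A3 : t * (1 - Cmod p) <= t * m) by (apply Rmult_le_compat_l; lra).
apply Rle_trans with ((1 - t) * ((1 + t) * m)).
- apply Rmult_le_compat_l; lra.
- replace ((1 - t) * ((1 + t) * m)) with ((1 + t) * ((1 - t) * m)) by ring.
  apply Rmult_le_compat_l; lra.
Qed.

(* Expand the polynomial Q(z) as a power series in w = mob p z, that is, expand
   Q o mob (-p): the partial sums converge uniformly on a circle of radius
   larger than 1, hence in norm by the Cauchy estimates. *)
Lemma mob_polynomials_dense_polynomials (nu : R) (p : C) (t : nat -> C) (m : nat)
  (f : dirichlet nu) (e : R) : Cmod p < 1 -> 0 < e ->
  (forall z : disk, f z = csum (fun k => t k * z ^ k)%C m) ->
  exists (c : nat -> C) (N : nat) (h : dirichlet nu),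
    (forall z : disk, h z = csum (fun k => c k * mob p z ^ k)%C N) /\ dnorm (minus f h) < e.
Proof.
intros Hp He Hf.
assert (H0 := Cmod_ge_0 p).
set (r := (1 + Cmod p) / 2).
assert (Hr : 0 < r < 1) by (unfold r; lra).
assert (Hpr : Cmod p < r) by (unfold r; lra).
(* Small enough that (1 + th) r < 1 - th. Then A, the bound for |mob p| on the circle of radius rho,
   still satisfies A r < 1. *)
set (th := (1 - r) / 4).
assert (Hth : 0 < th < 1) by (unfold th; lra).
set (rho := 1 + th * (1 - Cmod p)).
assert (Hrho1 : 0 < th * (1 - Cmod p)) by (apply Rmult_lt_0_compat; lra).
assert (Hrho2 : th * (1 - Cmod p) <= th * 1) by (apply Rmult_le_compat_l; lra).
set (A := (1 + th) / (1 - th)).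
assert (Hthr : (1 + th) * r < 1 - th).
{ assert (th * r <= th * 1) by (apply Rmult_le_compat_l; lra).
  unfold th in *; lra. }
assert (HA : A * r < 1).
{ unfold A; replace ((1 + th) / (1 - th) * r) with (((1 + th) * r) / (1 - th)) by (field; lra).
  apply Rlt_div_l; lra. }
assert (HA0 : 0 <= A) by (apply Rdiv_le_0_compat; lra).
assert (Hrr : rho * r < 1).
{ apply Rle_lt_trans with ((1 + th) * r); [|lra].
  apply Rmult_le_compat_r; unfold rho; lra. }
assert (Hprho : Cmod p * rho < 1).
{ apply Rle_lt_trans with (2 := Hrr); rewrite Rmult_comm; apply Rmult_le_compat_l; unfold rho; lra. }
(* [c] are the Taylor coefficients in w of Q o mob (-p); their series converges for |w| < 1/r, thus
   on |w| <= A. *)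
destruct (geo_csum r t (fun k z => (mob (- p) z ^ k)%C) m (proj1 Hr)) as [c Hc].
{ intros k; apply geo_mob_pow; rewrite Cmod_opp; exact Hpr. }
destruct (geo_tail r _ c A (proj1 Hr) HA0 HA Hc) as [M HM].
assert (Hx : 0 <= / rho < 1).
{ assert (1 < rho) by (unfold rho; lra).
  split; [apply Rlt_le, Rinv_0_lt_compat; lra|].
  rewrite <- Rinv_1; apply Rinv_lt_contravar; lra. }
destruct (dnorm_geom nu (/ rho) Hx) as [K [HK HKn]].
assert (Hlim : is_lim_seq (fun N => K * M * (A * r) ^ N) 0).
{ apply lim_geom; split; [apply Rmult_le_pos; lra | exact HA]. }
destruct (proj2 (is_lim_seq_spec _ _) Hlim (mkposreal e He)) as [N HN].
specialize (HN N (Nat.le_refl N)); simpl in HN; rewrite Rminus_0_r in HN.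
apply Rabs_def2, proj1 in HN.
destruct (geo_csum r c (fun k z => (mob p z ^ k)%C) N (proj1 Hr)) as [a Ha].
{ intros k; apply geo_mob_pow; exact Hpr. }
destruct (dirichlet_of_geo nu r _ _ Hr Ha) as [h [Hh _]].
exists c, N, h; split; [exact Hh|].
assert (HD := geo_plus _ _ _ _ _ (geo_trunc r t m (proj1 Hr)) (geo_scal r (-1) _ _ Ha)).
destruct (dirichlet_of_geo nu r _ _ Hr HD) as [D [HD1 HD2]].
replace (minus f h) with D.
2:{ apply dirichlet_ext; intros z; rewrite HD1, minusE, Hf, Hh; ring. }
(* Evaluate the tail at w = mob p z: since mob (-p) w = z, the expanded function takes the value
   Q(z) there. *)
assert (HB : forall z, Cmod z = rho ->
  Cmod (csum (fun k => t k * z ^ k) m + -1 * csum (fun k => c k * mob p z ^ k) N)%C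
    <= M * (A * r) ^ N).
{ intros z Hz.
  assert (Hm : Cmod (mob p z) <= A).
  { apply mob_near_circle; try assumption; rewrite Hz; exact Hprho. }
  assert (T := HM (mob p z) N Hm).
  rewrite mob_inv in T.
  - replace (csum (fun k => t k * z ^ k) m + -1 * csum (fun k => c k * mob p z ^ k) N)%C
      with (csum (fun k => t k * z ^ k) m - csum (fun k => c k * mob p z ^ k) N)%C by ring.
    exact T.
  - exact Hp.
  - apply one_minus_neq0; rewrite Cmod_conj, Hz; exact Hprho. }
assert (HB0 : 0 <= M * (A * r) ^ N).
{ apply Rle_trans with (2 := HB rho ltac:(rewrite Cmod_R, Rabs_pos_eq; unfold rho; lra)).
  apply Cmod_ge_0. }
apply Rle_lt_trans with (K * (M * (A * r) ^ N)); [|lra].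
apply HKn; [exact HB0|]; intros n; rewrite HD2.
assert (T := cauchy_estimate r rho _ _ _ (proj1 Hr) ltac:(unfold rho; lra) Hrr HB0 HD HB n).
rewrite pow_inv; apply Rle_div_r; [apply pow_lt; unfold rho; lra | exact T].
Qed.

Lemma mob_polynomials_dense (nu : R) (p : C) (f : dirichlet nu) (e : R) : Cmod p < 1 -> 0 < e ->
  exists (c : nat -> C) (N : nat) (h : dirichlet nu),
    (forall z : disk, h z = csum (fun k => c k * mob p z ^ k)%C N) /\ dnorm (minus f h) < e.
Proof.
intros Hp He.
destruct (polynomials_dense nu f (e / 2) ltac:(lra)) as [t [m [g [Hg1 Hg2]]]].
destruct (mob_polynomials_dense_polynomials nu p t m g (e / 2) Hp ltac:(lra) Hg1)
  as [c [N [h [Hh1 Hh2]]]].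
exists c, N, h; split; [exact Hh1|].
rewrite (minus_trans g f h).
apply Rle_lt_trans with (1 := dnorm_triangle nu _ _); lra.
Qed.

(** [B] is the sum of the norms of the first N powers of [mob p]. It is fixed before the
    coefficients, so it applies to the change produced by any iterate. *)
Lemma mob_polynomial_norm (nu : R) (p : C) (N : nat) : Cmod p < 1 ->
  exists B, 0 <= B /\ forall (c : nat -> C) (e : R) (h : dirichlet nu), 0 <= e ->
    (forall k, (k < N)%nat -> Cmod (c k) <= e) ->
    (forall z : disk, h z = csum (fun k => c k * mob p z ^ k)%C N) -> dnorm h <= B * e.
Proof.
intros Hp; assert (H0 := Cmod_ge_0 p).
induction N as [|N [B [HB IH]]].
- exists 0; split; [lra|]; intros c e h He _ Hh.
  replace h with (dzero nu); [rewrite dnorm_zero; lra|].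
  apply dirichlet_ext; intros z; rewrite Hh; reflexivity.
- destruct (geo_mob_pow ((1 + Cmod p) / 2) p N ltac:(lra)) as [a Ha].
  destruct (dirichlet_of_geo nu ((1 + Cmod p) / 2) _ _ ltac:(lra) Ha) as [A [HA _]].
  exists (B + dnorm A); split; [generalize (dnorm_ge0 nu A); lra|].
  intros c e h He Hc Hh.
  set (g := dplus nu h (dscal nu (- c N) A)).
  replace h with (dplus nu g (dscal nu (c N) A)).
  2:{ apply dirichlet_ext; intros z; unfold g; simpl; ring. }
  apply Rle_trans with (1 := dnorm_triangle nu _ _); rewrite dnorm_scal.
  replace ((B + dnorm A) * e) with (B * e + e * dnorm A) by ring.
  apply Rplus_le_compat.
  + apply (IH c); [exact He | intros; apply Hc; lia |].
    intros z; unfold g; simpl; rewrite Hh, HA; simpl; ring.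
  + apply Rmult_le_compat_r; [apply dnorm_ge0 | apply Hc; lia].
Qed.

(** * Simultaneous recurrence of two rotations *)

Lemma pigeonhole (T : Type) (f : nat -> T) (l : list T) :
  (forall n, In (f n) l) -> exists i j, (i < j)%nat /\ f i = f j.
Proof.
intros H; apply NNPP; intros N.
assert (inj : forall i j, f i = f j -> i = j).
{ intros i j E; destruct (Nat.lt_trichotomy i j) as [L|[L|L]]; [|exact L|];
    exfalso; apply N; [exists i, j | exists j, i]; auto. }
assert (U : NoDup (map f (seq 0 (S (length l))))).
{ apply NoDup_map_NoDup_ForallPairs; [intros i j _ _; apply inj | apply seq_NoDup]. }
apply NoDup_incl_length with (l' := l) in U.
- rewrite length_map, length_seq in U; lia.
- intros x Hx; apply in_map_iff in Hx; destruct Hx as [n [<- _]]; apply H.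
Qed.

(** Index of the grid cell of width 1/K containing x. For x >= -1 the integer is positive, so the
    passage to [nat] loses nothing. *)
Definition cell (K x : R) : nat := Z.to_nat (up ((x + 1) * K)).

Lemma cell_close (K x y : R) : 0 < K -> -1 <= x -> -1 <= y -> cell K x = cell K y ->
  Rabs (x - y) <= / K.
Proof.
intros HK Hx Hy E; unfold cell in E.
destruct (archimed ((x + 1) * K)) as [X1 X2], (archimed ((y + 1) * K)) as [Y1 Y2].
assert (0 <= (x + 1) * K) by (apply Rmult_le_pos; lra).
assert (0 <= (y + 1) * K) by (apply Rmult_le_pos; lra).
apply Z2Nat.inj in E; [| apply le_IZR; lra | apply le_IZR; lra].
rewrite E in X1, X2.
apply Rmult_le_reg_r with K; [exact HK|]; rewrite Rinv_l by lra.
rewrite <- (Rabs_pos_eq K) by lra; rewrite <- Rabs_mult.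
apply Rabs_le; lra.
Qed.

Lemma cell_in (K x : R) (n : nat) : 0 < K -> -1 <= x <= 1 -> 2 * K + 1 < INR n ->
  In (cell K x) (seq 0 n).
Proof.
intros HK Hx Hn; apply in_seq; split; [lia|]; simpl.
destruct (archimed ((x + 1) * K)) as [X1 X2].
assert (0 <= (x + 1) * K) by (apply Rmult_le_pos; lra).
assert ((x + 1) * K <= 2 * K) by (apply Rmult_le_compat_r; lra).
apply INR_lt; unfold cell.
rewrite INR_IZR_INZ, Z2Nat.id by (apply le_IZR; lra); lra.
Qed.

Lemma Cmod_le_parts (z : C) : Cmod z <= Rabs (fst z) + Rabs (snd z).
Proof.
assert (Ci1 : Cmod Ci = 1).
{ unfold Cmod, Ci; simpl; replace (0 * (0 * 1) + 1 * (1 * 1)) with 1 by ring; apply sqrt_1. }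
replace z with (fst z + Ci * snd z)%C at 1.
- apply Rle_trans with (1 := Cmod_triangle _ _).
  rewrite Cmod_mult, Ci1, !Cmod_R; lra.
- destruct z as [x y]; apply injective_projections; simpl; ring.
Qed.

Lemma unit_parts (z : C) : Cmod z = 1 -> -1 <= fst z <= 1 /\ -1 <= snd z <= 1.
Proof.
intros H; assert (M := Rmax_Cmod z); rewrite H in M.
assert (A := Rle_trans _ _ _ (Rmax_l _ _) M); assert (B := Rle_trans _ _ _ (Rmax_r _ _) M).
apply Rabs_le_between in A; apply Rabs_le_between in B; lra.
Qed.

Lemma unit_pow (z : C) (n : nat) : Cmod z = 1 -> Cmod (z ^ n)%C = 1.
Proof. intros H; rewrite Cmod_pow, H; apply pow1. Qed.

Lemma two_rotations_recur (x y : C) (e : R) : Cmod x = 1 -> Cmod y = 1 -> 0 < e ->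
  exists n, (0 < n)%nat /\ Cmod (x ^ n - 1)%C <= e /\ Cmod (y ^ n - 1)%C <= e.
Proof.
intros Hx Hy He.
(* Cells of width e/2, for the real and imaginary parts together to differ by at most e. *)
set (K := 2 / e); assert (HK : 0 < K) by (apply Rdiv_lt_0_compat; lra).
destruct (nfloor_ex (2 * K + 1) ltac:(lra)) as [n0 [_ Hn0]].
set (s := seq 0 (S n0)).
assert (Hs : forall w, -1 <= w <= 1 -> In (cell K w) s).
{ intros w Hw; apply cell_in; [exact HK | exact Hw | rewrite S_INR; lra]. }
destruct (pigeonhole _ (fun n => ((cell K (fst (x ^ n)%C), cell K (snd (x ^ n)%C)),
  (cell K (fst (y ^ n)%C), cell K (snd (y ^ n)%C))))
  (list_prod (list_prod s s) (list_prod s s))) as [i [j [Hij E]]].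
{ intros n; destruct (unit_parts _ (unit_pow x n Hx)), (unit_parts _ (unit_pow y n Hy)).
  repeat apply in_prod; apply Hs; assumption. }
injection E; intros E1 E2 E3 E4.
assert (close : forall w, Cmod w = 1 ->
  cell K (fst (w ^ i)%C) = cell K (fst (w ^ j)%C) ->
  cell K (snd (w ^ i)%C) = cell K (snd (w ^ j)%C) -> Cmod (w ^ (j - i) - 1)%C <= e).
{ intros w Hw F1 F2.
  destruct (unit_parts _ (unit_pow w i Hw)), (unit_parts _ (unit_pow w j Hw)).
  apply cell_close in F1; [|exact HK|lra|lra]; apply cell_close in F2; [|exact HK|lra|lra].
  assert (Ew : Cmod (w ^ (j - i) - 1)%C = Cmod (w ^ i - w ^ j)%C).
  { replace (w ^ i - w ^ j)%C with (- (w ^ i * (w ^ (j - i) - 1)))%C.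
    - rewrite Cmod_opp, Cmod_mult, (unit_pow w i Hw); ring.
    - replace j with (i + (j - i))%nat at 2 by lia; rewrite Cpow_add_r; ring. }
  rewrite Ew; apply Rle_trans with (1 := Cmod_le_parts _).
  assert (Ee : / K + / K = e) by (unfold K; field; lra).
  rewrite <- Ee; apply Rplus_le_compat; [exact F1 | exact F2]. }
exists (j - i)%nat; split; [lia|]; split; apply close; assumption.
Qed.

Lemma unit_mul_pow_close (x y : C) (e : R) (k : nat) : Cmod x = 1 -> Cmod y = 1 ->
  Cmod (x - 1)%C <= e -> Cmod (y - 1)%C <= e -> Cmod (x * y ^ k - 1)%C <= INR (S k) * e.
Proof.
intros Hx Hy Ex Ey; induction k as [|k IH].
- simpl; replace (x * 1 - 1)%C with (x - 1)%C by ring; lra.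
- rewrite S_INR; replace (x * y ^ S k - 1)%C with ((x * y ^ k - 1) * y + (y - 1))%C by (simpl; ring).
  apply Rle_trans with (1 := Cmod_triangle _ _); rewrite Cmod_mult, Hy; lra.
Qed.

(** The approximating polynomial [h] is itself the point that returns to U. The time n must suit the
    N eigenvalues lambda mu^k, and closeness of lambda^n and mu^n to 1 controls all of them. *)
Lemma rotation_recurrent (nu : R) (lambda mu : C) (phi : disk -> disk)
  (T : dirichlet nu -> dirichlet nu) (p : disk) :
  composition_operator phi T -> Cmod lambda = 1 -> Cmod mu = 1 ->
  (forall z : disk, mob p (phi z) = (mu * mob p z)%C) ->
  recurrent (fun f : dirichlet nu => scal lambda (T f)).
Proof.
intros HT Hl Hm Hrot U HU [f Hf].
assert (Hp := disk_lt1 p).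
destruct (HU f Hf) as [e He].
assert (He' : forall g : dirichlet nu, dnorm (minus g f) < e -> U g) by exact He.
assert (He0 := cond_pos e).
destruct (mob_polynomials_dense nu p f (e / 2) Hp ltac:(lra)) as [c [N [h [Hh Hfh]]]].
destruct (mob_polynomial_norm nu p N Hp) as [B [HB HBn]].
set (Cm := rsum (fun k => Cmod (c k)) N).
assert (HCm : 0 <= Cm) by (apply rsum_ge0; intros; apply Cmod_ge_0).
(* Each coefficient of [h] will move by at most N d Cm, hence [h] by at most B Cm N d in norm; the 1
   keeps the divisor positive. *)
set (d := e / 2 / (B * (Cm * INR N) + 1)).
assert (HN0 := pos_INR N).
assert (HQ : 0 <= B * (Cm * INR N)) by (repeat apply Rmult_le_pos; lra).
assert (Hd : 0 < d) by (apply Rdiv_lt_0_compat; lra).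
destruct (two_rotations_recur lambda mu d Hl Hm Hd) as [n [Hn [El Em]]].
set (S' := fun g : dirichlet nu => scal lambda (T g)) in *.
assert (Hit : forall m (z : disk), (Nat.iter m S' h : dirichlet nu) z
  = csum (fun k => (lambda * mu ^ k) ^ m * c k * mob p z ^ k)%C N).
{ induction m as [|m IH]; intros z.
  - simpl; rewrite Hh; apply csum_ext; intros k _; ring.
  - change ((Nat.iter (S m) S' h : dirichlet nu) z)
      with (lambda * T (Nat.iter m S' h) z)%C.
    rewrite HT, IH, <- csum_scal; apply csum_ext; intros k _.
    rewrite Hrot, (Cpow_mult_l mu), Cpow_S; ring. }
exists n; split; [exact Hn|]; exists h; split.
- apply He'; rewrite <- opp_minus.
  change (dnorm (dopp nu (minus f h)) < e); rewrite dnorm_opp; lra.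
- apply He'; rewrite (minus_trans h).
  apply Rle_lt_trans with (1 := dnorm_triangle nu _ _).
  assert (A1 : dnorm (minus h f) < e / 2).
  { rewrite <- opp_minus; change (dnorm (dopp nu (minus f h)) < e / 2).
    rewrite dnorm_opp; exact Hfh. }
  assert (A2 : dnorm (minus (Nat.iter n S' h) h) <= B * (Cm * INR N * d)).
  { apply (HBn (fun k => ((lambda * mu ^ k) ^ n - 1) * c k)%C).
    - apply Rmult_le_pos; [apply Rmult_le_pos|]; lra.
    - intros k Hk; rewrite Cmod_mult.
      replace (Cm * INR N * d) with (INR N * d * Cm) by ring.
      apply Rmult_le_compat; try apply Cmod_ge_0.
      + rewrite Cpow_mult_l, <- Cpow_mult_r, Nat.mul_comm, Cpow_mult_r.
        apply Rle_trans with (INR (S k) * d).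
        * apply unit_mul_pow_close; try assumption; apply unit_pow; assumption.
        * apply Rmult_le_compat_r; [lra | apply le_INR; lia].
      + apply (rsum_term (fun k => Cmod (c k))); [intros; apply Cmod_ge_0 | exact Hk].
    - intros z; rewrite minusE, Hit, Hh.
      replace (csum (fun k => (lambda * mu ^ k) ^ n * c k * mob p z ^ k) N
        - csum (fun k => c k * mob p z ^ k) N)%C
        with (csum (fun k => (lambda * mu ^ k) ^ n * c k * mob p z ^ k) N
        + (-1) * csum (fun k => c k * mob p z ^ k) N)%C by ring.
      rewrite <- csum_scal, <- csum_plus; apply csum_ext; intros; ring. }
  assert (A3 : B * (Cm * INR N * d) <= e / 2).
  { replace (B * (Cm * INR N * d)) with (B * (Cm * INR N) * d) by ring.
    apply Rle_trans with ((B * (Cm * INR N) + 1) * d).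
    - apply Rmult_le_compat_r; lra.
    - right; unfold d; field; lra. }
  change (dnorm (minus (Nat.iter n S' h) h) + dnorm (minus h f) < e); lra.
Qed.

(** * Elliptic automorphisms are rotations *)

(* In homogeneous coordinates S M = mu S becomes a polynomial identity, which
   differentiated at the fixed point p gives phi'(p) = mu or 1/mu, according to
   whether S(p) is 0 or infinity. *)
Lemma elliptic_derivative (phi : disk -> disk) (p : disk) (k : C) :
  (exists z, phi z <> z) -> phi p = p -> hasder (fun z => phi z : C) p k ->
  elliptic_automorphism phi -> Cmod k = 1.
Proof.
intros [z1 Hz1] Ep Hk [_ [M [[_ [_ [_ [S [mu [[a [b [c [d [Hdet HS]]]]] [Hmu HSM]]]]]]] HM]]].
(* Holds at poles too: infinity is fixed by the dilation, so S has a pole at z exactly when it has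
   one at phi z, and then both sides vanish. *)
assert (Q : forall z : disk,
  ((a * phi z + b) * (c * z + d))%C = (mu * ((a * z + b) * (c * phi z + d)))%C).
{ intros z; assert (E := HSM (Some (z : C))); rewrite HM, !HS in E.
  destruct (Ceq_dec (c * z + d)%C 0%C) as [Ez|Ez].
  - rewrite (lft_pole _ _ _ _ _ Ez) in E.
    unfold dilation in E; rewrite (lft_None_0 mu 0 0 1 eq_refl) in E.
    destruct (Ceq_dec (c * phi z + d)%C 0%C) as [Ef|Ef].
    + rewrite Ez, Ef; ring.
    + rewrite lft_Some in E by exact Ef; discriminate.
  - rewrite (lft_Some _ _ _ _ z Ez) in E; unfold dilation in E.
    rewrite (lft_Some mu 0 0 1) in E.
    2:{ replace (0 * ((a * z + b) / (c * z + d)) + 1)%C with (RtoC 1) by ring; apply C1_nz. }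
    destruct (Ceq_dec (c * phi z + d)%C 0%C) as [Ef|Ef].
    + rewrite lft_pole in E by exact Ef; discriminate.
    + rewrite lft_Some in E by exact Ef.
      assert (inj : forall u v : C, Some u = Some v -> u = v) by (intros; congruence).
      assert (E3 : ((a * phi z + b) / (c * phi z + d))%C = (mu * ((a * z + b) / (c * z + d)))%C).
      { rewrite (inj _ _ E); field; exact Ez. }
      transitivity (((a * phi z + b) / (c * phi z + d)) * ((c * phi z + d) * (c * z + d)))%C;
        [field; exact Ef|].
      rewrite E3; field; exact Ez. }
(* For mu = 1 the identity becomes (a d - b c) (phi z - z) = 0, contradicting the moved point
   [z1]. *)
assert (mu1 : mu <> RtoC 1).
{ intros E; apply Hz1, disk_eq, (proj2 (Ceq_minus _ _)).
  assert (Qz := Q z1); rewrite E in Qz.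
  destruct (Cmult_integral (a * d - b * c) (phi z1 - z1)) as [F|F]; [|contradiction|exact F].
  replace ((a * d - b * c) * (phi z1 - z1))%C with ((a * phi z1 + b) * (c * z1 + d)
    - 1 * ((a * z1 + b) * (c * phi z1 + d)))%C by ring.
  rewrite Qz; ring. }
assert (Der : (a * k * (c * p + d) + (a * p + b) * c)%C
  = (mu * (a * (c * p + d) + (a * p + b) * (c * k)))%C).
{ apply (hasder_unique (fun z => (a * phi z + b) * (c * z + d))%C p).
  - replace (a * k * (c * p + d) + (a * p + b) * c)%C
      with ((a * k + 0) * (c * p + d) + (a * phi p + b) * (c * 1 + 0))%C by (rewrite Ep; ring).
    apply (hasder_mult (fun z => (a * phi z + b)%C) (fun z : disk => (c * z + d)%C)).
    + apply hasder_plus; [apply hasder_scal, Hk | apply hasder_const].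
    + apply hasder_plus; [apply hasder_scal, hasder_id | apply hasder_const].
  - apply hasder_ext with (fun z : disk => mu * ((a * z + b) * (c * phi z + d)))%C.
    { intros z; rewrite Q; reflexivity. }
    apply hasder_scal.
    replace (a * (c * p + d) + (a * p + b) * (c * k))%C
      with ((a * 1 + 0) * (c * phi p + d) + (a * p + b) * (c * k + 0))%C by (rewrite Ep; ring).
    apply (hasder_mult (fun z : disk => (a * z + b)%C) (fun z => (c * phi z + d)%C)).
    + apply hasder_plus; [apply hasder_scal, hasder_id | apply hasder_const].
    + apply hasder_plus; [apply hasder_scal, Hk | apply hasder_const]. }
assert (Qp := Q p); rewrite Ep in Qp.
(* The undifferentiated identity at p: S(p) is fixed by the dilation, hence is 0 or infinity. In
   either case the factor left over in [Der] is, up to sign, the determinant. *)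
assert (Z : ((1 - mu) * ((a * p + b) * (c * p + d)))%C = RtoC 0).
{ replace ((1 - mu) * ((a * p + b) * (c * p + d)))%C with
    ((a * p + b) * (c * p + d) - mu * ((a * p + b) * (c * p + d)))%C by ring.
  rewrite <- Qp; ring. }
apply Cmult_integral in Z; destruct Z as [Z|Z].
{ destruct mu1; symmetry; apply (proj2 (Ceq_minus _ _)), Z. }
apply Cmult_integral in Z; destruct Z as [Z|Z]; rewrite Z in Der.
- assert (E : ((a * (c * p + d)) * (k - mu))%C = RtoC 0).
  { replace ((a * (c * p + d)) * (k - mu))%C with
      ((a * k * (c * p + d) + 0 * c) - mu * (a * (c * p + d) + 0 * (c * k)))%C by ring.
    rewrite Der; ring. }
  apply Cmult_integral in E; destruct E as [E|E].
  + destruct Hdet; rewrite <- E.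
    replace (a * d - b * c)%C with (a * (c * p + d) - c * (a * p + b))%C by ring.
    rewrite Z; ring.
  + rewrite (proj2 (Ceq_minus _ _) E); exact Hmu.
- assert (E : (((a * p + b) * c) * (1 - mu * k))%C = RtoC 0).
  { replace (((a * p + b) * c) * (1 - mu * k))%C with
      ((a * k * 0 + (a * p + b) * c) - mu * (a * 0 + (a * p + b) * (c * k)))%C by ring.
    rewrite Der; ring. }
  apply Cmult_integral in E; destruct E as [E|E].
  + destruct Hdet.
    replace (a * d - b * c)%C with (a * (c * p + d) - (a * p + b) * c)%C by ring.
    rewrite Z, E; ring.
  + apply (proj2 (Ceq_minus _ _)) in E; apply (f_equal Cmod) in E.
    rewrite Cmod_1, Cmod_mult, Hmu in E; lra.
Qed.

Theorem theorem3p1 (nu : R) (lambda : C) (phi : disk -> disk)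
  (phi_holomorphic : holomorphic (fun z : disk => phi z : C))
  (phi_nonconstant : ~ exists c : disk, forall z : disk, phi z = c)
  (phi_not_id : exists z : disk, phi z <> z)
  (phi_fixed_point : exists z : disk, phi z = z)
  (C_phi : dirichlet nu -> dirichlet nu)
  (C_phi_comp : composition_operator phi C_phi)
  (C_phi_bounded : @is_linear C_AbsRing (dirichlet_NormedModule nu)
                     (dirichlet_NormedModule nu) C_phi) :
  recurrent (fun f : dirichlet nu => scal lambda (C_phi f)) <->
  elliptic_automorphism phi /\ Cmod lambda = 1%R.
Proof.
destruct phi_fixed_point as [p Ep]; split.
- intros Hrec.
  destruct (recurrent_rotation nu lambda phi C_phi p C_phi_comp Ep Hrec) as [Hl [mu [Hmu Hrot]]].
  split; [|exact Hl].
  exact (rotation_elliptic_automorphism phi p mu phi_holomorphic phi_not_id Hmu Hrot).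
- intros [Hell Hl].
  destruct (composition_symbol_hasder nu phi C_phi p C_phi_comp) as [k Hk].
  destruct (composition_rotation nu phi C_phi p k C_phi_comp Ep Hk
    (elliptic_derivative phi p k phi_not_id Ep Hk Hell)) as [mu [Hmu Hrot]].
  exact (rotation_recurrent nu lambda mu phi C_phi p C_phi_comp Hl Hmu Hrot).
Qed.
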